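(* Fix an alternating nonzero automaton $\mathcal A$ with limited choice for Adam (and satisfying (NLL)), with state set $Q$ and Eve states $Q_E$. The set of strategic trees $T_{t,\sigma}:\{0,1\}^*\to(Q\cup Q\times Q)^{Q_E}$ such that $\sigma$ is a positional strategy of Eve winning the acceptance game of $t$ can be recognized by a non-deterministic nonzero automaton (over the alphabet $(Q\cup Q\times Q)^{Q_E}$) whose size is exponential in $|Q|$. If $F_\forall=Q$ in $\mathcal A$, then the $F_\forall$ set (sure condition) of this non-deterministic automaton is a Büchi condition.
   Context: A $\Sigma$-labelled binary tree is a map $t:\{0,1\}^*\to\Sigma$. An alternating nonzero automaton on finite alphabet $\Sigma$ is $\mathcal A=(Q,q_0,Q_E,Q_A,\to,F_\forall,F_1,F_{>0})$: $Q$ finite, totally ordered by $\le$, $q_0$ initial, $(Q_E,Q_A)$ a partition of $Q$ into Eve's and Adam's states, transitions are local $q\to_a q'$ or split $q\to_a(q_0',q_1')$, $F_\forall,F_1,F_{>0}\subseteq Q$; standing assumptions: every $(q,a)$ has a transition, split transitions with source in $F_{>0}$ have a target in $F_{>0}$, local transitions with source in $F_{>0}$ have target in $F_{>0}$, $F_1\subseteq F_\forall$. Acceptance game on $t$: vertices $(n,q)$, start $(\epsilon,q_0)$; the owner of $q$ picks a transition with source $q$ and letter $t(n)$; local $q\to q'$ leads to $(n,q')$, split $q\to(r_0,r_1)$ leads to $(n0,r_0)$ or $(n1,r_1)$ with probability $1/2$ each; strategies $\sigma$ (Eve), $\tau$ (Adam) induce a measure $\mathbb P^{\sigma,\tau}$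 on plays. Limsup of a play = largest state seen infinitely often. $\sigma$ is winning if against every $\tau$: every consistent play has limsup in $F_\forall$; almost every play has limsup in $F_1$; every finite consistent play ending in a state of $F_{>0}$ has, with positive probability, continuations whose later states all lie in $F_{>0}$. A tree is accepted if Eve has a winning strategy. Transition graph: vertices $Q$, edge $q\to r$ if $q\to_a r$ is local or $r$ is a target of a split transition from $q$; $q\equiv r$ iff same strongly connected component. Limited choice for Adam: for every $q\in Q_A$ all transitions from $q$ are local and for each $a$ at most one $q\to_a q'$ has $q\equiv q'$. (NLL): no cycle $q_0\to_a q_1\to_a\cdots\to_a q_0$ of local transitions on a single letter $a$. A strategy $\sigma$ of Eve is positional if $\sigma(\pi)=\sigma(\pi')$ whenever the finite plays $\pi,\pi'$ have the same last vertex. For a tree $t$ and positional $\sigma$, $T_{t,\sigma}(n)(q)=q'$ if $\sigma$ plays the local transition $q\to_{t(n)}q'$ at $(n,q)$ and $T_{t,\sigma}(n)(q)=(q_0,q_1)$ if it plays the split transition $q\to_{t(n)}(q_0,q_1)$, for $q\in Q_E$. A tree $T:\{0,1\}^*\to(Q\cup Q\times Q)^{Q_E}$ is strategic if $T=T_{t,\sigma}$ for some $t$ and positional $\sigma$. A non-deterministic nonzero automaton is an alternating nonzero automaton with $Q_A=\emptyset$ and only split transitions. A set $F\subseteq Q$ is a Büchi condition if it is upward closed for $\le$. *)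

(* Defs.v *)
From HB Require Import structures.
From mathcomp Require Import all_boot all_order all_algebra.
From mathcomp Require Import all_classical all_reals all_analysis.
From mathcomp Require Import lra.
Import Order.TTheory GRing.Theory Num.Theory.
Import numFieldNormedType.Exports.

Set Implicit Arguments.
Unset Strict Implicit.
Unset Printing Implicit Defensive.

Local Open Scope classical_set_scope.
Local Open Scope ring_scope.

Definition node := seq bool.
Definition tree (S : Type) := node -> S.

(* [inl r] is the local transition to [r], [inr (r0, r1)] the split one. *)
Definition move (Q : Type) : Type := (Q + Q * Q)%type.

(* The states controlled by Adam are those outside [eve]. *)
Record nzaut (S : finType) (d : Order.disp_t) (Q : finOrderType d) := NzAut {
  init : Q;
  eve : {set Q};
  trans : {set Q * S * move Q};
  Fall : {set Q};
  Fone : {set Q};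
  Fpos : {set Q};
  trans_total : forall q a, exists m, (q, a, m) \in trans;
  Fpos_split : forall q a r0 r1, q \in Fpos ->
    (q, a, inr (r0, r1)) \in trans -> (r0 \in Fpos) || (r1 \in Fpos);
  Fpos_local : forall q a r, q \in Fpos ->
    (q, a, inl r) \in trans -> r \in Fpos;
  Fone_sub_Fall : Fone \subset Fall
}.

Definition adam (S : finType) d (Q : finOrderType d) (A : nzaut S Q) : {set Q} :=
  ~: eve A.

Definition aut_size (S : finType) d (Q : finOrderType d) (A : nzaut S Q) : nat :=
  (#|Q| + #|trans A|)%N.

Section Structure.
Context (S : finType) (d : Order.disp_t) (Q : finOrderType d) (A : nzaut S Q).

Definition edge : rel Q := fun q r => [exists a, ((q, a, inl r) \in trans A) ||
  [exists r', ((q, a, inr (r, r')) \in trans A) ||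
              ((q, a, inr (r', r)) \in trans A)]].

Definition same_scc (q r : Q) := connect edge q r && connect edge r q.

Definition limited_choice : Prop := forall q, q \in adam A ->
  (forall a m, (q, a, m) \in trans A -> exists r, m = inl r) /\
  (forall a r r', (q, a, inl r) \in trans A -> (q, a, inl r') \in trans A ->
     same_scc q r -> same_scc q r' -> r = r').

Definition NLL : Prop := forall (a : S) (c : seq Q), c != [::] ->
  ~~ cycle (fun q r => (q, a, inl r) \in trans A) c.

Definition nondeterministic : Prop :=
  adam A = finset.set0 /\
  (forall q a m, (q, a, m) \in trans A -> exists r0 r1, m = inr (r0, r1)).

End Structure.

Definition buchi d (Q : finOrderType d) (F : {set Q}) : Prop :=
  forall q r, q \in F -> (q <= r)%O -> r \in F.

Definition vertex (Q : Type) : Type := (node * Q)%type.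

(* [sigma h v] is the move chosen after the finite play [rcons h v].  Only the
   moves at the vertices of the player are relevant. *)
Definition strategy (Q : Type) := seq (vertex Q) -> vertex Q -> move Q.

Definition play (S : finType) d (Q : finOrderType d) (A : nzaut S Q) : Type :=
  nat -> vertex Q.

Section Game.
Context (S : finType) (d : Order.disp_t) (Q : finOrderType d) (A : nzaut S Q).

HB.instance Definition _ := Choice.on (play A).
HB.instance Definition _ := isPointed.Build (play A) (fun=> ([::], init A)).

Definition start : vertex Q := ([::], init A).

Definition legal (t : tree S) (V : {set Q}) (sigma : strategy Q) : Prop :=
  forall h v, v.2 \in V -> (v.2, t v.1, sigma h v) \in trans A.

Definition next (m : move Q) (v : vertex Q) (b : bool) : vertex Q :=
  match m with
  | inl r => (v.1, r)
  | inr (r0, r1) => (rcons v.1 b, if b then r1 else r0)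
  end.

Definition chosen (sigma tau : strategy Q) : strategy Q :=
  fun h v => if v.2 \in eve A then sigma h v else tau h v.

Fixpoint consistent_from (sigma tau : strategy Q) (h : seq (vertex Q))
    (v : vertex Q) (s : seq (vertex Q)) : bool :=
  if s is w :: s' then
    [exists b, w == next (chosen sigma tau h v) v b] &&
    consistent_from sigma tau (rcons h v) w s'
  else true.

Definition fin_consistent (sigma tau : strategy Q) (s : seq (vertex Q)) : bool :=
  if s is v :: s' then (v == start) && consistent_from sigma tau [::] v s'
  else true.

Definition consistent (sigma tau : strategy Q) (rho : play A) : Prop :=
  forall k, fin_consistent sigma tau (mkseq rho k).

Definition inf_often (rho : play A) (q : Q) : Prop :=
  forall N, exists2 i, (N <= i)%N & (rho i).2 = q.

Definition limsup_in (F : {set Q}) (rho : play A) : Prop :=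
  exists q, [/\ q \in F, inf_often rho q &
    forall r, inf_often rho r -> (r <= q)%O].

Definition cylinder (s : seq (vertex Q)) : set (play A) :=
  [set rho | mkseq rho (size s) = s].

Definition plays := g_sigma_algebraType (range cylinder).

Section Measure.
Context (R : realType) (sigma tau : strategy Q).

(* The two successors of a split transition are always distinct, because they
   lie at distinct nodes. *)
Definition step_prob (m : move Q) (v w : vertex Q) : R :=
  match m with
  | inl r => (w == (v.1, r))%:R
  | inr (r0, r1) => ((w == (rcons v.1 false, r0))%:R +
                     (w == (rcons v.1 true, r1))%:R) / 2
  end.

Fixpoint path_prob (h : seq (vertex Q)) (v : vertex Q) (s : seq (vertex Q)) : R :=
  if s is w :: s' then
    step_prob (chosen sigma tau h v) v w * path_prob (rcons h v) w s'
  else 1.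

Definition play_prob (s : seq (vertex Q)) : R :=
  if s is v :: s' then (v == start)%:R * path_prob [::] v s' else 1.

(* Existence of the induced measure: a point of [0, 1[ supplies the coin tosses
   through its binary expansion. *)
Let cstate : Type := (seq (vertex Q) * vertex Q * R)%type.

Let coin_step (c : cstate) : cstate :=
  let: (h, v, x) := c in
  match chosen sigma tau h v with
  | inl r => (rcons h v, (v.1, r), x)
  | inr (r0, r1) =>
      if x < 1 / 2 then (rcons h v, (rcons v.1 false, r0), 2 * x)
      else (rcons h v, (rcons v.1 true, r1), 2 * x - 1)
  end.

Let coin_play (c : cstate) : nat -> vertex Q := fun i => (iter i coin_step c).1.2.

Let coin_playS h v x i :
  coin_play (h, v, x) i.+1 = coin_play (coin_step (h, v, x)) i.
Proof. by rewrite /coin_play iterSr. Qed.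

Let mkseqS (f : nat -> vertex Q) n :
  mkseq f n.+1 = f 0%N :: mkseq (fun i => f i.+1) n.
Proof. by rewrite /mkseq /= -[1%N]addn0 iotaDl -map_comp. Qed.

Let coin_path h v s : exists a : R,
  [/\ 0 <= a, 0 <= path_prob h v s, a + path_prob h v s <= 1 &
   forall x : R, 0 <= x < 1 ->
    (mkseq (fun i => coin_play (h, v, x) i.+1) (size s) = s) <->
    (a <= x < a + path_prob h v s)].
Proof.
elim: s h v => [|w s IH] h v /=.
  by exists 0; rewrite add0r; split=> // x xI; split.
have mkE x : mkseq (fun i => coin_play (h, v, x) i.+1) (size s).+1 =
    (coin_step (h, v, x)).1.2 ::
    mkseq (fun i => coin_play (coin_step (h, v, x)) i.+1) (size s).
  rewrite mkseqS; congr cons.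
  by apply: eq_map => i; rewrite coin_playS.
have [a [a0 p0 ap IHs]] := IH (rcons h v) w.
move: IHs p0 ap; set p := path_prob _ _ _ => IHs p0 ap.
case E : (chosen sigma tau h v) => [r|[r0 r1]] /=.
  case: eqP => [ew|new].
    rewrite mul1r; exists a; split=> // x xI.
    rewrite mkE /coin_step E /= -ew.
    by rewrite -IHs//; split => [[]//|->].
  exists 0; rewrite mul0r addr0; split=> // x xI.
  rewrite mkE /coin_step E /=; split => [[ew]|]; last by move=> ?; exfalso; lra.
  by case: new.
have mixed b0 b1 : (rcons v.1 true, b1) <> (rcons v.1 false, b0) :> vertex Q.
  by case=> /eqP; rewrite eqseq_rcons andbF.
case: (eqVneq w (rcons v.1 false, r0)) => [ew0|nw0].
  have -> : (w == (rcons v.1 true, r1)) = false.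
    by apply/eqP => e; apply: (@mixed r0 r1); rewrite -e.
  exists (a / 2); rewrite /= addr0; split; try by lra.
  move=> x xI; rewrite mkE /coin_step E /=.
  case: ltP => hx /=.
    have xI' : 0 <= 2 * x < 1 by lra.
    have {}IHs := IHs _ xI'.
    rewrite -ew0; split => [[]/IHs|]; first by lra.
    by move=> K; congr cons; apply/IHs; lra.
  split => [[]|]; last by move=> ?; exfalso; lra.
  by rewrite ew0 => /mixed.
case: (eqVneq w (rcons v.1 true, r1)) => [ew1|nw1].
  exists ((a + 1) / 2); rewrite /= add0r; split; try by lra.
  move=> x xI; rewrite mkE /coin_step E /=.
  case: ltP => hx /=.
    split => [[]|]; last by move=> ?; exfalso; lra.
    by rewrite ew1 => /esym/mixed.
  have xI' : 0 <= 2 * x - 1 < 1 by lra.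
  have {}IHs := IHs _ xI'.
  rewrite -ew1; split => [[]/IHs|]; first by lra.
  by move=> K; congr cons; apply/IHs; lra.
exists 0; rewrite /= !addr0 mul0r mul0r addr0; split=> //.
move=> x xI; rewrite mkE /coin_step E /=; split; last by move=> ?; exfalso; lra.
by case: ltP => _ [] ew; move: nw0 nw1; rewrite ew eqxx.
Qed.

Let unitI (x : R) : R := if 0 <= x < 1 then x else 0.

Let rho_of (x : R) : plays := coin_play ([::], start, unitI x).

Let rho_of_cylinder s : exists a : R,
  [/\ 0 <= a, 0 <= play_prob s, a + play_prob s <= 1 &
   forall x : R, 0 <= x < 1 ->
    cylinder s (rho_of x) <-> (a <= x < a + play_prob s)].
Proof.
rewrite /cylinder /rho_of; case: s => [|v s] /=.
  exists 0; rewrite add0r; split=> // x xI; split=> //.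
case: eqP => [->|nv]; last first.
  exists 0; rewrite mul0r addr0; split=> // x xI; split; last first.
    by case/andP=> /le_lt_trans/[apply]; rewrite ltxx.
  by rewrite mkseqS /coin_play /= => -[]/esym.
have [a [a0 p0 ap H]] := coin_path [::] start s.
exists a; rewrite mul1r; split=> // x xI.
by rewrite mkseqS -H// /unitI xI /coin_play /=; split => [[]|->].
Qed.

Let preim_cylinder s : measurable (rho_of @^-1` cylinder s).
Proof.
have [a [a0 p0 ap H]] := rho_of_cylinder s.
have -> : rho_of @^-1` cylinder s =
    `[a, (a + play_prob s)[%classic `|`
    (if `[< cylinder s (rho_of 0) >] then ~` `[0, 1[%classic else set0).
  apply/seteqP; split => x /=.
    case: (boolP (0 <= x < 1)) => xI.
      by move/(H _ xI) => K; left; rewrite in_itv.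
    rewrite /rho_of /unitI (negbTE xI) => K; right.
    rewrite lexx ltr01 /= asboolT//= in_itv /=.
    exact/negP.
  move=> [|].
    rewrite in_itv /= => K; apply/H => //; lra.
  case: asboolP => // K; rewrite /= in_itv /= => /negP xI.
  by move: K; rewrite /rho_of /unitI lexx ltr01 (negbTE xI).
apply: measurableU; first exact: measurable_itv.
by case: ifP => _; [apply: measurableC; exact: measurable_itv|exact: measurable0].
Qed.

Let mrho_of : measurable_fun [set: R] rho_of.
Proof.
apply: (@measurability _ _ R plays setT rho_of (range cylinder) (erefl _)).
by move=> _ [_ [s _ <-] <-]; rewrite setTI; exact: preim_cylinder.
Qed.

Lemma play_measure_exists : exists P : probability plays R,
  forall s, P (cylinder s) = (play_prob s)%:E.
Proof.
have mI : measurable (`[0%R, 1%R[%classic : set R) by exact: measurable_itv.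
pose m : {measure set (measurableTypeR R) -> \bar R} :=
  mrestr (@lebesgue_measure R) mI.
have mT : m setT = 1%E.
  by rewrite /m /= /mrestr setTI lebesgue_measure_itv /= lte_fin ltr01 sube0.
pose mp := HB.pack_for (probability (measurableTypeR R) R) (m : set _ -> \bar R)
  (Measure.class m) (Measure_isProbability.Build _ _ _ m mT).
pose f := HB.pack_for {mfun measurableTypeR R >-> plays} rho_of
  (isMeasurableFun.Build _ _ (measurableTypeR R) plays rho_of mrho_of).
exists (distribution mp f) => s.
rewrite /distribution /pushforward /= /mrestr.
have [a [a0 p0 ap H]] := rho_of_cylinder s.
have -> : rho_of @^-1` cylinder s `&` `[0, 1[%classic =
    `[a, (a + play_prob s)[%classic.
  apply/seteqP; split => x /=; rewrite !in_itv /=.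
    by move=> [K xI]; apply/H.
  move=> K; have xI : 0 <= x < 1 by lra.
  by split=> //; apply/H.
rewrite lebesgue_measure_itv /= lte_fin.
case: ltP => [_|]; first by rewrite -EFinB addrAC subrr add0r.
by rewrite gerDl => q0; congr (_%:E); apply/eqP; rewrite eq_le p0 q0.
Qed.

(* The unique probability on plays with the prescribed values on cylinders. *)
Definition play_measure : probability plays R := sval (cid play_measure_exists).

Lemma play_measureE s : play_measure (cylinder s) = (play_prob s)%:E.
Proof. exact: (svalP (cid play_measure_exists)). Qed.

End Measure.

(* The positive probability is that of the consistent finite play together with
   a continuation in [Fpos]; such a finite play has itself positive probability,
   so conditioning on it would give the same condition. *)
Definition winning (R : realType) (t : tree S) (sigma : strategy Q) : Prop :=
  legal t (eve A) sigma /\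
  forall tau, legal t (adam A) tau ->
  [/\ forall rho, consistent sigma tau rho -> limsup_in (Fall A) rho,
      {ae play_measure R sigma tau, forall rho, limsup_in (Fone A) rho} &
      forall s v, fin_consistent sigma tau (rcons s v) -> v.2 \in Fpos A ->
        (0 < play_measure R sigma tau (cylinder (rcons s v) `&`
           [set rho | forall i, (size s <= i)%N -> (rho i).2 \in Fpos A]))%E].

Definition accepts (R : realType) (t : tree S) : Prop :=
  exists sigma, winning R t sigma.

Definition positional (sigma : strategy Q) : Prop :=
  forall h h' v, v.2 \in eve A -> sigma h v = sigma h' v.

Definition strat_alphabet : finType :=
  {ffun {q : Q | q \in eve A} -> move Q}.

(* [sigma] is meant to be positional, so the choice of the history [[::]] is
   immaterial. *)
Definition strategic_tree (sigma : strategy Q) : tree strat_alphabet :=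
  fun n => [ffun q => sigma [::] (n, val q)].

End Game.

(* Main.v *)
(* Let Adam's strategy [star] stay in the current strongly connected component
   whenever a transition allows it.  Limited choice and (NLL) make every play
   follow [star] from some point on, so that along a fixed branch the limsups of
   all plays are those of the finitely many "tokens" that walk down the branch
   deterministically; as Adam's deviations from [star] form a countable set, the
   almost-sure condition may be exchanged with the quantification over Adam's
   strategies.  If Adam could leave [Fpos] almost surely, then from a state with a
   minimal set of reachable states he could only do so by playing [star], so the
   positive condition also concerns [star] alone.

   The automaton keeps the tokens in ranked slots (ranks never increase, so each
   token eventually owns a slot), and a latest appearance record of the states
   visited by each slot decides both limsup conditions by one priority.  For the
   positive condition it tracks one token at a time in its own [Fpos]; every other
   token in [Fpos] is owed a walk to a place where it is tracked, and breakpoints,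
   at which all owed tokens have been served, must occur infinitely often: this is
   the Buchi condition.  Conversely, when Eve's strategy wins, the branches followed
   by the walks are countably many, so the tracked event can be shrunk to one that
   avoids them all and still has positive probability. *)

Require Import Defs.
From HB Require Import structures.
From mathcomp Require Import all_boot all_order all_algebra.
From mathcomp Require Import all_classical all_reals all_analysis.
From mathcomp Require Import lra zify.
Import Order.TTheory GRing.Theory Num.Theory.
Import numFieldNormedType.Exports.

Set Implicit Arguments.
Unset Strict Implicit.
Unset Printing Implicit Defensive.

Local Open Scope classical_set_scope.
Local Open Scope ring_scope.

Local Notation next := Defs.next.

(** * Branches and plays *)

(** Once both strategies are fixed, a play is a function of the branch it walks down. All measures
    on plays are thus images of one fair coin measure on branches, and events that belong to
    different strategies of Adam can be intersected. The alphabet of strategic trees does not show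
    the letters of [t]: the automaton guesses them, and the guesses of an accepting run make up the
    witness. By (NLL) fewer than [#|Q|] local moves follow each other at a node, so one transition
    of the automaton sums up all that happens there. The obstacle is that breakpoints are demanded
    on every branch, while tracking is only controlled up to positive probability. Debts are
    therefore paid along single walks, and a debt that would never be paid leads along a walk on
    which, by the choice of the tracked event, tracking must stop and an owed token must be picked
    next. A record relates about [#|Q| ^ 2] colours, which gives the exponent 4. *)

Definition branch : Type := nat -> bool.
HB.instance Definition _ := Choice.on branch.
HB.instance Definition _ := isPointed.Build branch (fun=> false).

Definition cone (n : node) : set branch := [set b | mkseq b (size n) = n].

Definition branches := g_sigma_algebraType (range cone).

Lemma cone_mkseq (b : branch) k : cone (mkseq b k) b.
Proof. by rewrite /cone /= size_mkseq. Qed.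

Lemma cone_rcons n c (b : branch) : cone (rcons n c) b <-> cone n b /\ b (size n) = c.
Proof.
rewrite /cone /= size_rcons mkseqS; split => [/rcons_inj[-> ->]//|[-> ->]//].
Qed.

Lemma take_mkseq (T : Type) (f : nat -> T) j k :
  (j <= k)%N -> take j (mkseq f k) = mkseq f j.
Proof. by move=> jk; rewrite /mkseq -map_take take_iota (minn_idPl jk). Qed.

Lemma cone_prefix n n' (b : branch) : prefix n n' -> cone n' b -> cone n b.
Proof.
rewrite /cone /= => pn e; move: (size_prefix pn); rewrite -{1}e size_mkseq => le_n.
by move: pn; rewrite prefixE => /eqP; rewrite -{1}e take_mkseq.
Qed.

Lemma mkseqSl (T : Type) (f : nat -> T) n :
  mkseq f n.+1 = f 0%N :: mkseq (fun i => f i.+1) n.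
Proof. by rewrite /mkseq /= -[1%N]addn0 iotaDl -map_comp. Qed.

Section PlayOf.
Context (S : finType) (d : Order.disp_t) (Q : finOrderType d) (A : nzaut S Q).
Context (sigma tau : strategy Q).
Implicit Types (h s : seq (vertex Q)) (v w : vertex Q) (b : branch).

Local Notation chosen := (chosen A sigma tau).
Local Notation consistent_from := (consistent_from A sigma tau).

(** The bit consulted is indexed by the depth of the current node and not by time, so local moves
    consume none. *)
Definition game_step b (c : seq (vertex Q) * vertex Q) :=
  (rcons c.1 c.2, next (chosen c.1 c.2) c.2 (b (size c.2.1))).

Definition play_of b : play A :=
  fun i => (iter i (game_step b) ([::], start A)).2.

Lemma game_history b h v i : (iter i (game_step b) (h, v)).1 =
  h ++ mkseq (fun j => (iter j (game_step b) (h, v)).2) i.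
Proof.
elim: i => [|i IH]; first by rewrite cats0.
by rewrite iterS /= IH mkseqS rcons_cat.
Qed.

Lemma play_ofS b i : play_of b i.+1 =
  next (chosen (mkseq (play_of b) i) (play_of b i)) (play_of b i)
       (b (size (play_of b i).1)).
Proof. by rewrite {1}/play_of iterS /= game_history. Qed.

Lemma next_cone m v b : cone v.1 b -> cone (next m v (b (size v.1))).1 b.
Proof. by case: m => [r|[r0 r1]] //= ?; apply/cone_rcons. Qed.

Lemma play_of_cone b i : cone (play_of b i).1 b.
Proof. by elim: i => // i IH; rewrite play_ofS; exact: next_cone. Qed.

Lemma next_prefix (m : move Q) v c : prefix v.1 (next m v c).1.
Proof. by case: m => [r|[r0 r1]] /=; rewrite ?prefix_refl ?prefix_rcons. Qed.

Lemma consistent_from_prefix h v s :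
  consistent_from h v s -> prefix v.1 (last v s).1.
Proof.
elim: s h v => [|w s IH] h v /=; first by rewrite prefix_refl.
case/andP=> /existsP[c /eqP ->] /IH; apply: prefix_trans; exact: next_prefix.
Qed.

(** A wrong bit at a split shows in the last node, since nodes only grow along a play; this is why
    comparing [b] with the last node is enough. *)
Lemma game_consistent b h v s : cone v.1 b ->
  mkseq (fun i => (iter i.+1 (game_step b) (h, v)).2) (size s) = s <->
  consistent_from h v s /\ cone (last v s).1 b.
Proof.
elim: s h v => [|w s IH] h v vb /=; first by split.
rewrite mkseqSl /=.
have -> : mkseq (fun i => (iter i.+2 (game_step b) (h, v)).2) (size s) =
  mkseq (fun i => (iter i.+1 (game_step b)
    (rcons h v, next (chosen h v) v (b (size v.1)))).2) (size s).
  by apply: eq_map => i; rewrite [in LHS]iterSr.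
have [->|wN] := eqVneq w (next (chosen h v) v (b (size v.1))).
  have := IH (rcons h v) _ (next_cone (chosen h v) vb).
  move=> IHs; split.
    case=> /IHs[-> ?]; split => //; rewrite andbT; apply/existsP.
    by exists (b (size v.1)).
  by case=> /andP[_ c1 c2]; congr cons; apply/IHs.
split; first by case=> e; rewrite e eqxx in wN.
case=> /andP[/existsP[c /eqP wE] /consistent_from_prefix sp lb].
move: (cone_prefix sp lb) wN; rewrite wE.
case: (chosen h v) => [r|[r0 r1]] /=; first by rewrite eqxx.
by case/cone_rcons=> _ ->; rewrite eqxx.
Qed.

Lemma play_of_cylinder s b : play_of b \in cylinder (A := A) s =
  fin_consistent A sigma tau s && (b \in cone (last (start A) s).1).
Proof.
apply/idP/idP; rewrite inE /cylinder /=.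
  case: s => [|v s] /=; first by move=> _; rewrite mem_set.
  rewrite mkseqSl => -[<-] /game_consistent [] // -> /mem_set.
  by rewrite eqxx => ->.
case/andP; case: s => [|v s] //= /andP[/eqP -> cs] /set_mem bs.
by rewrite mkseqSl; congr cons; exact/game_consistent.
Qed.

Lemma fin_consistent_play_of b k : fin_consistent A sigma tau (mkseq (play_of b) k).
Proof.
have : play_of b \in cylinder (A := A) (mkseq (play_of b) k).
  by rewrite inE /cylinder /= size_mkseq.
by rewrite play_of_cylinder => /andP[].
Qed.

Lemma consistent_play_of b : consistent sigma tau (play_of b).
Proof. by move=> k; exact: fin_consistent_play_of. Qed.

(** Each split halves the probability and lengthens the node by one; local moves change neither. *)
Lemma path_prob_cone (R : realType) h v s :
  path_prob A R sigma tau h v s = (consistent_from h v s)%:R *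
    (2 ^- size (last v s).1 * 2 ^+ size v.1).
Proof.
elim: s h v => [|w s IH] h v /=.
  by rewrite mul1r mulVf// expf_neq0.
rewrite IH; case E : (chosen h v) => [r|[r0 r1]] /=.
  have -> : [exists b : bool, w == (v.1, r)] = (w == (v.1, r)).
    by apply/idP/idP => [/existsP[]//|?]; apply/existsP; exists true.
  have [->|] /= := eqVneq; last by rewrite !mul0r.
  by rewrite mul1r.
have mixed c0 c1 : (rcons v.1 true, c1) <> (rcons v.1 false, c0) :> vertex Q.
  by case=> /eqP; rewrite eqseq_rcons andbF.
have -> : [exists b : bool, w == (rcons v.1 b, if b then r1 else r0)] =
    (w == (rcons v.1 false, r0)) || (w == (rcons v.1 true, r1)).
  apply/idP/idP; first by case/existsP=> -[] ->; rewrite ?orbT.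
  by move=> e; apply/existsP; case/orP: e => ?; [exists false|exists true].
have [->|_] /= := eqVneq w (rcons v.1 false, r0).
  rewrite (_ : (_ == _) = false) ?addr0; last first.
    by apply/eqP => /esym/mixed.
  by rewrite size_rcons exprS; case: (consistent_from _ _ _); rewrite ?mul0r ?mulr0//; lra.
have [->|_] /= := eqVneq w (rcons v.1 true, r1).
  by rewrite add0r size_rcons exprS; case: (consistent_from _ _ _); rewrite ?mul0r ?mulr0//; lra.
by rewrite addr0 !mul0r.
Qed.

Lemma play_prob_cone (R : realType) s : play_prob A R sigma tau s =
  (fin_consistent A sigma tau s)%:R * 2 ^- size (last (start A) s).1.
Proof.
case: s => [|v s] /=; first by rewrite invr1 mulr1.
rewrite path_prob_cone; have [->|] /= := eqVneq; last by rewrite !mul0r.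
by rewrite mul1r expr0 mulr1.
Qed.

End PlayOf.

(** * The fair coin measure on branches *)

Section MeasurablePlays.
Context (S : finType) (d : Order.disp_t) (Q : finOrderType d) (A : nzaut S Q).

Lemma measurable_cylinder s : measurable (cylinder s : set (plays A)).
Proof. by apply: sub_sigma_algebra; exists s. Qed.

(** Finite plays are countable, so such an event is a countable union of cylinders. *)
Lemma measurable_play_prefix N (P : seq (vertex Q) -> Prop) :
  measurable [set rho : plays A | P (mkseq rho N)].
Proof.
pose F i : set (plays A) := if @unpickle (seq (vertex Q)) i is Some s
  then (if `[< size s = N /\ P s >] then cylinder s else set0) else set0.
have -> : [set rho : plays A | P (mkseq rho N)] = \bigcup_i F i.
  apply/seteqP; split => rho /=.
    move=> Prho; exists (pickle (mkseq rho N)) => //.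
    by rewrite /F pickleK size_mkseq asboolT// /cylinder /= size_mkseq.
  case=> i _; rewrite /F; case: unpickle => // s.
  by case: asboolP => // -[sN Ps]; rewrite /cylinder /= sN => ->.
apply: bigcupT_measurable => i; rewrite /F; case: unpickle => // s.
by case: ifP => // _; exact: measurable_cylinder.
Qed.

Lemma measurable_play_state i (F : {set Q}) :
  measurable [set rho : plays A | (rho i).2 \in F].
Proof.
rewrite (_ : [set _ | _] = [set rho : plays A |
    (nth (start A) (mkseq rho i.+1) i).2 \in F]).
  exact: (measurable_play_prefix i.+1 (fun s => (nth (start A) s i).2 \in F)).
by apply/seteqP; split => rho /=; rewrite nth_mkseq.
Qed.

Lemma measurable_inf_often q : measurable [set rho : plays A | inf_often (rho : play A) q].
Proof.
rewrite (_ : [set _ | _] = \bigcap_N \bigcup_i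
    ([set rho : plays A | (rho i).2 \in [set q]%SET] `&` [set _ | (N <= i)%N])).
  apply: bigcapT_measurable => N; apply: bigcupT_measurable => i.
  apply: measurableI; first exact: measurable_play_state.
  have [Ni|Ni] := boolP (N <= i)%N.
    by rewrite (_ : [set _ | _] = setT)//; apply/seteqP; split.
  by rewrite (_ : [set _ | _] = set0)//; apply/seteqP; split.
apply/seteqP; split => rho /= io N.
  by move=> _; have [i Ni e] := io N; exists i => //=; rewrite e finset.in_set1.
by have [i _ /= []] := io N I; rewrite finset.in_set1 => /eqP e Ni; exists i.
Qed.

Lemma measurable_limsup_in F : measurable [set rho : plays A | limsup_in F (rho : play A)].
Proof.
rewrite (_ : [set _ | _] = \bigcup_(q in [set q | q \in F])
    ([set rho : plays A | inf_often (rho : play A) q] `&`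
     \bigcap_(r in [set r | ~~ (r <= q)%O]) ~` [set rho : plays A | inf_often (rho : play A) r])).
  apply: fin_bigcup_measurable; first exact: finite_finset.
  move=> q _; apply: measurableI; first exact: measurable_inf_often.
  apply: fin_bigcap_measurable; first exact: finite_finset.
  by move=> r _; apply: measurableC; exact: measurable_inf_often.
apply/seteqP; split => rho /=.
  case=> q [qF io mx]; exists q => //=; split=> // r /= /negP rq ior.
  by apply: rq; exact: mx.
case=> q /= qF [io mx]; exists q; split=> // r ior.
by apply: contrapT => /negP rq; apply: (mx r).
Qed.

End MeasurablePlays.

Lemma measurable_cone n : measurable (cone n : set branches).
Proof. by apply: sub_sigma_algebra; exists n. Qed.

Lemma measurable_branch_prefix N (P : node -> Prop) :
  measurable [set b : branches | P (mkseq b N)].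
Proof.
pose F i : set branches := if @unpickle node i is Some s
  then (if `[< size s = N /\ P s >] then cone s else set0) else set0.
have -> : [set b : branches | P (mkseq b N)] = \bigcup_i F i.
  apply/seteqP; split => b /=.
    move=> Pb; exists (pickle (mkseq b N)) => //.
    by rewrite /F pickleK size_mkseq asboolT// /cone /= size_mkseq.
  case=> i _; rewrite /F; case: unpickle => // s.
  by case: asboolP => // -[sN Ps]; rewrite /cone /= sN => ->.
apply: bigcupT_measurable => i; rewrite /F; case: unpickle => // s.
by case: ifP => // _; exact: measurable_cone.
Qed.

Lemma measurable_play_of (S : finType) d (Q : finOrderType d) (A : nzaut S Q)
    sigma tau :
  measurable_fun [set: branches] (play_of A sigma tau : branches -> plays A).
Proof.
apply: (@measurability _ _ branches (plays A) setT _ (range (@cylinder S d Q A)) (erefl _)).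
move=> _ [_ [s _ <-] <-]; rewrite setTI.
have [cs|cs] := boolP (fin_consistent A sigma tau s).
  rewrite (_ : _ @^-1` _ = cone (last (start A) s).1); first exact: measurable_cone.
  apply/seteqP; split => b /= bs; apply/set_mem; move/mem_set: bs;
    by rewrite play_of_cylinder cs.
rewrite (_ : _ @^-1` _ = set0)//; apply/seteqP; split => b //= /mem_set.
by rewrite play_of_cylinder (negbTE cs).
Qed.

(** A game that only lends its measure: when both players always split, the nodes of a play record
    fair coin tosses. *)
Lemma coin_tosser : nzaut unit 'I_1.
Proof.
apply: (@NzAut unit _ 'I_1 ord0 finset.setT finset.setT finset.set0 finset.set0 finset.set0).
- by move=> q a; exists (inl ord0); rewrite finset.in_setT.
- by move=> q a r0 r1; rewrite finset.in_set0.
- by move=> q a r; rewrite finset.in_set0.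
- by rewrite finset.sub0set.
Qed.

(** * Fair coin measure, and measures on plays as its images *)

Section Coin.
Context (R : realType).

Local Notation A0 := coin_tosser.

Let sg : strategy 'I_1 := fun _ _ => inr (ord0, ord0).

Let bits (rho : plays A0) : branches := fun k => nth false (rho k.+1).1 k.

Let mbits : measurable_fun [set: plays A0] bits.
Proof.
apply: (@measurability _ _ (plays A0) branches setT _ (range cone) (erefl _)).
move=> _ [_ [n _ <-] <-]; rewrite setTI.
pose P s := mkseq (fun k => nth false (nth (start A0) s k.+1).1 k) (size n) = n.
rewrite (_ : _ @^-1` _ = [set rho : plays A0 | P (mkseq rho (size n).+1)]).
  exact: measurable_play_prefix.
apply: eq_set => rho; rewrite /P /bits /cone /=.
congr (_ = _); apply/eq_in_map => k; rewrite mem_iota => /andP[_ kn].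
by have <- : nth (start A0) (mkseq rho (size n).+1) k.+1 = rho k.+1 by rewrite nth_mkseq.
Qed.

Let play_ofE b i : play_of A0 sg sg b i = (mkseq b i, ord0).
Proof.
elim: i => [|i IH]; first by rewrite /play_of /= /start (ord1 (init A0)).
rewrite play_ofS IH.
have -> h v : chosen A0 sg sg h v = inr (ord0, ord0) by rewrite /chosen; case: ifP.
by rewrite /= mkseqS size_mkseq if_same.
Qed.

Lemma coin_exists : exists P : probability branches R,
  forall n, P (cone n) = (2 ^- size n)%:E.
Proof.
pose f := HB.pack_for {mfun plays A0 >-> branches} bits
  (isMeasurableFun.Build _ _ (plays A0) branches bits mbits).
pose P : probability branches R := distribution (play_measure A0 R sg sg) f.
have ge n : ((2 ^- size n)%:E <= P (cone n))%E.
  pose s := mkseq (play_of A0 sg sg (fun k => nth false n k)) (size n).+1.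
  have ls : (last (start A0) s).1 = n.
    by rewrite /s mkseqS last_rcons play_ofE /= mkseq_nth.
  rewrite /P /distribution /pushforward /=.
  have <- : play_measure A0 R sg sg (cylinder s) = (2 ^- size n)%:E.
    by rewrite play_measureE play_prob_cone fin_consistent_play_of mul1r ls.
  apply: le_measure; rewrite ?inE; first exact: measurable_cylinder.
    by rewrite -[X in measurable X]setTI; apply: mbits => //; exact: measurable_cone.
  have sE : size s = (size n).+1 by rewrite size_mkseq.
  move=> rho; rewrite /cylinder /cone /mkset sE => e.
  change (mkseq (bits rho) (size n) = n).
  rewrite -[RHS](mkseq_nth false); apply/eq_in_map => k.
  rewrite mem_iota /= add0n => kn; rewrite /bits.
  have -> : rho k.+1 = nth (start A0) (mkseq rho (size n).+1) k.+1.
    by rewrite nth_mkseq// ltnS.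
  by rewrite e nth_mkseq ?ltnS// play_ofE /= nth_mkseq.
(* Lower bounds suffice: the measures of the two children are at least half that of their parent and
   add up to it. *)
exists P => n; move: P ge => P ge; elim/last_ind: n => [|n c IH].
  rewrite /= invr1 (_ : cone _ = setT); first exact: probability_setT.
  by apply/seteqP; split.
have cU : cone n = cone (rcons n c) `|` cone (rcons n (~~ c)).
  apply/seteqP; split => b /=.
    move=> nb; have [e|e] := eqVneq (b (size n)) c; [left|right]; apply/cone_rcons; split=> //.
    by case: (b _) (c) e => -[].
  by case=> /cone_rcons[].
have : P (cone n) = (P (cone (rcons n c)) + P (cone (rcons n (~~ c))))%E.
  rewrite cU (measureU P)//; try exact: measurable_cone.
  apply/seteqP; split => b //= -[/cone_rcons[_ e1] /cone_rcons[_]].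
  by rewrite e1; case: (c).
rewrite IH => e; apply/eqP; rewrite eq_le ge andbT.
move: e (ge (rcons n (~~ c))).
have -> : P (cone (rcons n c)) = (fine (P (cone (rcons n c))))%:E.
  by rewrite fineK// fin_num_measure//; exact: measurable_cone.
have -> : P (cone (rcons n (~~ c))) = (fine (P (cone (rcons n (~~ c)))))%:E.
  by rewrite fineK// fin_num_measure//; exact: measurable_cone.
move: (fine _) (fine _) => x y [].
rewrite !size_rcons !lee_fin exprS invfM; set z := 2 ^- size n; lra.
Qed.

Definition coin : probability branches R := sval (cid coin_exists).

Lemma coin_cone n : coin (cone n) = (2 ^- size n)%:E.
Proof. exact: (svalP (cid coin_exists)). Qed.

(** Two cylinders are nested or disjoint, so with the empty set they form a pi-system generating the
    events; on it both sides are known explicitly. *)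
Lemma play_measure_coin (S : finType) d (Q : finOrderType d) (A : nzaut S Q)
    sigma tau (E : set (plays A)) : measurable E ->
  play_measure A R sigma tau E = coin (play_of A sigma tau @^-1` E).
Proof.
pose f := HB.pack_for {mfun branches >-> plays A} (play_of A sigma tau : branches -> plays A)
  (isMeasurableFun.Build _ _ branches (plays A) _ (measurable_play_of (A := A) sigma tau)).
pose G : set (set (plays A)) := range (@cylinder S d Q A) `|` [set set0].
move=> mE.
apply: (@measure_unique _ R (plays A) G (fun=> cylinder [::]) _ _ _ _
  (play_measure A R sigma tau) (distribution coin f)) => //.
- apply/seteqP; split.
    by apply: sub_sigma_algebra2 => X ?; left.
  apply: smallest_sub; first exact: sigma_algebra_measurable.
  by move=> X [[s _ <-]|->]; [exact: measurable_cylinder|exact: measurable0].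
- have GI s s' : (size s <= size s')%N -> G (cylinder s `&` cylinder s').
    move=> ss'; have [e|ne] := eqVneq (take (size s) s') s.
      left; exists s' => //; apply/seteqP; split => rho /=; last by case.
      move=> rs'; split=> //; rewrite /cylinder /= -[RHS]e -[in RHS]rs' take_mkseq//.
    right; apply/seteqP; split => rho //= -[rs rs'].
    by move/eqP: ne; apply; rewrite -rs' take_mkseq.
  move=> X Y [[s _ <-]|->]; last by right; rewrite set0I.
  move=> [[s' _ <-]|->]; last by right; rewrite setI0.
  by case/orP: (leq_total (size s) (size s')) => ?; [|rewrite setIC]; exact: GI.
- by move=> _; left; exists [::].
- by apply/seteqP; split => // rho _; exists 0%N.
- move=> _ [[s _ <-]|->]; last by rewrite !measure0.
  transitivity (play_prob A R sigma tau s)%:E; first exact: play_measureE.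
  rewrite play_prob_cone /distribution /pushforward /=.
  have [cs|cs] := boolP (fin_consistent A sigma tau s).
    rewrite mul1r -coin_cone; congr (coin _).
    apply/seteqP; split => b /= bs; apply/set_mem; move/mem_set: bs;
    by rewrite play_of_cylinder cs.
  rewrite mul0r -[LHS](measure0 coin); congr (coin _).
  apply/seteqP; split => b //= /mem_set.
  by rewrite play_of_cylinder (negbTE cs).
- by move=> _; rewrite (le_lt_trans (probability_le1 _ _)) ?ltry//; exact: measurable_cylinder.
Qed.

End Coin.

Lemma ae_coin_imply (R : realType) (P P' : branch -> Prop) :
  (forall b, P b -> P' b) ->
  {ae coin R, forall b, P b} -> {ae coin R, forall b, P' b}.
Proof.
move=> PP'; have F : Filter (almost_everywhere (coin R)).
  exact: ae_filter_ringOfSetsType.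
exact: (@filterS _ _ F _ _ PP').
Qed.

Lemma ae_coin_forall (R : realType) (I : Type) (f : I -> nat) (g : nat -> I)
    (P : I -> branch -> Prop) : cancel f g ->
  (forall i, {ae coin R, forall b, P i b}) ->
  {ae coin R, forall b, forall i, P i b}.
Proof.
move=> fK aeP; have : {ae coin R, forall b, forall i, P (g i) b}.
  by apply: ae_foralln => i; exact: aeP.
by apply: ae_coin_imply => b Pb i; rewrite -(fK i).
Qed.

(** * Local moves *)

Lemma nonincreasing_stable (f : nat -> nat) N0 :
  (forall i, (N0 <= i)%N -> (f i.+1 <= f i)%N) ->
  exists2 N, (N0 <= N)%N & forall i, (N <= i)%N -> f i = f N.
Proof.
elim: {N0}(f N0) {-2}N0 (leqnn (f N0)) => [|c IH] N0 fc fS.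
  have f0 i : (N0 <= i)%N -> f i = 0%N.
    elim: i => [|i IHi]; first by rewrite leqn0 => /eqP N00; apply/eqP; rewrite -leqn0 -{1}N00.
    rewrite leq_eqVlt => /orP[/eqP <-|]; first by apply/eqP; rewrite -leqn0.
    by rewrite ltnS => iN; apply/eqP; rewrite -leqn0 -(IHi iN) fS.
  by exists N0 => // i iN; rewrite !f0.
have [[i iN fi]|nex] := pselect (exists2 i, (N0 <= i)%N & (f i < f N0)%N).
  have [||N iN' ?] := IH i; first by rewrite -ltnS (leq_trans fi).
    by move=> j ij; apply: fS; exact: leq_trans ij.
  by exists N => //; exact: leq_trans iN'.
exists N0 => // i; elim: i => [|i IHi]; first by rewrite leqn0 => /eqP ->.
rewrite leq_eqVlt => /orP[/eqP <- //|]; rewrite ltnS => iN.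
apply/eqP; rewrite eqn_leq -{1}(IHi iN) fS //= leqNgt.
by apply/negP => lt; apply: nex; exists i.+1 => //; exact: leqW.
Qed.

(* Recursion on the nodes of the binary tree, which grow at their right end. *)
Section NodeRec.
Context (X : Type) (x0 : X) (step : node -> X -> bool -> X).

Fixpoint node_rev_rec (n : node) : X :=
  if n is c :: n' then step (rev n') (node_rev_rec n') c else x0.

Definition node_rec (n : node) : X := node_rev_rec (rev n).

Lemma node_rec_rcons n c : node_rec (rcons n c) = step n (node_rec n) c.
Proof. by rewrite /node_rec rev_rcons /= revK. Qed.

End NodeRec.

Section Descent.
Context (Q : finType) (m : Q -> move Q).

Definition local_step (q : Q) : Q := if m q is inl r then r else q.

Definition visited (q : Q) : {set Q} := [set r | fconnect local_step q r]%SET.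

(** [local_step] fixes split states, and for legal moves (NLL) ensures that one is reached within
    [#|Q|] steps. *)
Definition split_state (q : Q) : Q := iter #|Q| local_step q.

Definition descend (c : bool) (q : Q) : Q :=
  if m (split_state q) is inr (r0, r1) then if c then r1 else r0 else q.

Definition is_split (q : Q) : bool := if m q is inr _ then true else false.

Lemma iter_local_stop q i : is_split (iter i local_step q) ->
  forall j, (i <= j)%N -> iter j local_step q = iter i local_step q.
Proof.
move=> sp j /subnK <-; elim: (j - i)%N => // k IH.
rewrite addSn iterS IH; move: sp; set r := iter i _ q.
by rewrite /is_split /local_step; case: (m r).
Qed.

(** [local_step] idles at a split state whereas a play moves on. The least index at which [r] is
    reached involves no idling, so a play makes these very steps. *)
Lemma visited_prefix q r : r \in visited q -> exists2 c,
  iter c local_step q = r & forall i, (i < c)%N -> ~~ is_split (iter i local_step q).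
Proof.
rewrite inE => /iter_findex; move: (findex _ _ _) => c0 c0E.
have exc : exists c, iter c local_step q == r by exists c0; rewrite c0E.
case: (ex_minnP exc) => c /eqP cE mn; exists c => // i ic; apply/negP => sp.
have := mn i; rewrite -(iter_local_stop sp (ltnW ic)) cE eqxx => /(_ isT).
by rewrite leqNgt ic.
Qed.

Lemma visited_refl q : q \in visited q.
Proof. by rewrite inE connect0. Qed.

Lemma visited_local q r r' : r \in visited q -> m r = inl r' -> r' \in visited q.
Proof.
rewrite !inE => qr mr; apply: connect_trans qr (connect1 _).
by rewrite /= /local_step mr.
Qed.

End Descent.

Section LocalMoves.
Context (S : finType) (d : Order.disp_t) (Q : finOrderType d) (A : nzaut S Q).
Implicit Types (q r : Q) (a : S) (l : strat_alphabet A).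

Definition star a q : Q :=
  if [pick r | ((q, a, inl r) \in trans A) && same_scc A q r] is Some r then r
  else if [pick r | (q, a, inl r) \in trans A] is Some r then r else q.

(** A letter only fixes the moves of Eve; [star] completes it at Adam's states, so that tokens move
    deterministically. *)
Definition letter_move a l q : move Q :=
  if insub q is Some u then l u else inl (star a q).

Definition legal_letter a l : bool :=
  [forall u : {q : Q | q \in eve A}, (val u, a, l u) \in trans A].

Hypothesis (lc : limited_choice A) (nll : NLL A).

Lemma star_trans a q : q \notin eve A -> (q, a, inl (star a q)) \in trans A.
Proof.
move=> qA; rewrite /star; case: pickP => [r /andP[] //|_].
case: pickP => [r //|]; have [m qm] := trans_total A q a.
have [|loc _] := lc (q := q); first by rewrite /adam finset.in_setC.
by have [r mr] := loc _ _ qm; move=> /(_ r); rewrite -mr qm.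
Qed.

Lemma starE a q r : q \notin eve A -> (q, a, inl r) \in trans A ->
  same_scc A q r -> star a q = r.
Proof.
move=> qA qr sqr; rewrite /star; case: pickP => [r' /andP[qr' sqr']|/(_ r)]; last first.
  by rewrite qr sqr.
have [|_] := lc (q := q); first by rewrite /adam finset.in_setC.
by move=> /(_ a _ _ qr' qr sqr' sqr).
Qed.

Lemma letter_move_trans a l q : legal_letter a l ->
  (q, a, letter_move a l q) \in trans A.
Proof.
move=> /forallP leg; rewrite /letter_move.
case: insubP => [u _ <-|qA]; first exact: leg.
exact: star_trans.
Qed.

Lemma letter_move_split a l q r0 r1 :
  letter_move a l q = inr (r0, r1) -> q \in eve A.
Proof. by rewrite /letter_move; case: insubP. Qed.

(** Among [#|Q|.+1] states two coincide, and the segment between them is a cycle of local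
    transitions on one letter. *)
Lemma local_chain_bounded a (s : nat -> Q) :
  ~ (forall j, (j < #|Q|)%N -> (s j, a, inl (s j.+1)) \in trans A).
Proof.
move=> st.
have /injectivePn [i [j ij sij]] : ~~ injectiveb (fun i : 'I_#|Q|.+1 => s i).
  by apply/negP => /injectiveP/leq_card; rewrite card_ord ltnn.
wlog lt_ij : i j ij sij / (i < j)%N.
  move=> W; have [|ji] := ltnP i j; first exact: W.
  by apply: (W j i) => //; rewrite 1?eq_sym // ltn_neqAle eq_sym ij.
pose c := mkseq (fun k => s (i + k)%N) (j - i).
have cN : c != [::] by rewrite -size_eq0 size_mkseq subn_eq0 -ltnNge.
have /negP := nll a cN; apply.
have cE : c = s i :: mkseq (fun k => s (i + k.+1)%N) (j - i.+1).
  by rewrite /c -(subnSK lt_ij) mkseqSl addn0.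
rewrite cE /= (_ : rcons _ _ = mkseq (fun k => s (i + k.+1)%N) (j - i)); last first.
  by rewrite -(subnSK lt_ij) mkseqS subnSK // (subnKC (ltnW lt_ij)) sij.
apply/(pathP (s i)) => k; rewrite size_mkseq => kj.
have -> : nth (s i) (s i :: mkseq (fun k => s (i + k.+1)%N) (j - i)) k = s (i + k)%N.
  by case: k kj => [|k] kj /=; rewrite ?addn0 // nth_mkseq // (ltnW kj).
rewrite nth_mkseq // addnS; apply: st.
have jQ : (j <= #|Q|)%N by rewrite -ltnS.
by move: kj; rewrite ltn_subRL => /leq_trans; apply.
Qed.

Section LegalMoves.
Context (a : S) (m : Q -> move Q).
Hypothesis mT : forall q, (q, a, m q) \in trans A.

Lemma split_stateP q : is_split m (split_state m q).
Proof.
apply: contrapT => /negP nsp.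
have nsp' j : (j <= #|Q|)%N -> ~~ is_split m (iter j (local_step m) q).
  by move=> jQ; apply: contra nsp => sp; rewrite /split_state (iter_local_stop sp jQ).
apply: (@local_chain_bounded a (fun j => iter j (local_step m) q)) => j jQ.
have := mT (iter j (local_step m) q); move: (nsp' j (ltnW jQ)).
by rewrite iterS; set r := iter j _ q; rewrite /local_step /is_split; case: (m r).
Qed.

Lemma visited_split q r : r \in visited m q -> is_split m r -> r = split_state m q.
Proof.
case/visited_prefix => c <- nsp sp; have [cQ|cQ] := leqP c #|Q|.
  by rewrite /split_state (iter_local_stop sp cQ).
by have := nsp _ cQ; rewrite split_stateP.
Qed.

Lemma split_state_visited q : split_state m q \in visited m q.
Proof. by rewrite inE; exact: fconnect_iter. Qed.

End LegalMoves.

End LocalMoves.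

(** * Tokens *)

Section Tokens.
Context (S : finType) (d : Order.disp_t) (Q : finOrderType d) (A : nzaut S Q).

Definition local_move a (m : Q -> move Q) : rel Q := fun q r =>
  if q \in eve A then m q == inl r else (q, a, inl r) \in trans A.

Definition local_closure a m (E : {set Q}) : {set Q} :=
  [set r | [exists q in E, connect (local_move a m) q r]]%SET.

(** A node is left from a state of Eve only, as limited choice makes all transitions of Adam
    local. *)
Definition next_entry a m c (E : {set Q}) : {set Q} :=
  [set r | [exists q in local_closure a m E, (q \in eve A) &&
     if m q is inr (r0, r1) then r == (if c then r1 else r0) else false]]%SET.

Context (t : tree S) (T : tree (strat_alphabet A)).

Definition move_at (n : node) : Q -> move Q := letter_move (t n) (T n).

(* The states in which some play can enter a given node, whatever Adam does. *)
Definition entry : node -> {set Q} :=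
  node_rec [set init A]%SET (fun n E c => next_entry (t n) (move_at n) c E).

Definition reach n : {set Q} := local_closure (t n) (move_at n) (entry n).

(* The states in which the play following [star] from [(mkseq b k, q)] enters
   the nodes of the branch [b]. *)
Fixpoint orbit b k q j : Q :=
  if j is j'.+1 then
    descend (move_at (mkseq b (k + j'))) (b (k + j')%N) (orbit b k q j')
  else q.

Definition visited_inf b k q r :=
  forall J, exists2 j, (J <= j)%N &
    r \in visited (move_at (mkseq b (k + j))) (orbit b k q j).

Definition orbit_limsup_in (F : {set Q}) b k q :=
  exists r, [/\ r \in F, visited_inf b k q r &
    forall r', visited_inf b k q r' -> (r' <= r)%O].

(** Testing the states that enter the nodes is enough: local moves do not leave [Fpos A]. *)
Definition stay n q : set branch :=
  [set b | cone n b /\ forall j, orbit b (size n) q j \in Fpos A].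

Lemma entry_rcons n c :
  entry (rcons n c) = next_entry (t n) (move_at n) c (entry n).
Proof. exact: node_rec_rcons. Qed.

Lemma entry_reach n q : q \in entry n -> q \in reach n.
Proof. by move=> qn; rewrite inE; apply/existsP; exists q; rewrite qn connect0. Qed.

Lemma reach_local n q r : q \in reach n ->
  local_move (t n) (move_at n) q r -> r \in reach n.
Proof.
rewrite !inE => /existsP[p /andP[pn pq]] qr; apply/existsP; exists p.
by rewrite pn (connect_trans pq)// connect1.
Qed.

Lemma reach_split n q r0 r1 c : q \in reach n -> move_at n q = inr (r0, r1) ->
  (if c then r1 else r0) \in entry (rcons n c).
Proof.
move=> qn mq; rewrite entry_rcons inE; apply/existsP; exists q.
by rewrite qn mq (letter_move_split mq) eqxx.
Qed.

Lemma orbit_ext b b' k q j : (forall i, (i < k + j)%N -> b i = b' i) ->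
  orbit b k q j = orbit b' k q j.
Proof.
elim: j => //= j IH e; rewrite IH; last by move=> i ij; apply: e; rewrite addnS ltnS ltnW.
rewrite e ?addnS//; congr (descend (move_at _) _ _).
by apply/eq_in_map => i; rewrite mem_iota => /andP[_ ij]; apply: e; rewrite addnS ltnS ltnW.
Qed.

Lemma orbitSl b k q j : orbit b k q j.+1 =
  orbit b k.+1 (descend (move_at (mkseq b k)) (b k) q) j.
Proof.
elim: j => [|j IH]; first by rewrite /= addn0.
by rewrite -[LHS]/(descend _ _ (orbit b k q j.+1)) IH addnS -addSn.
Qed.

Lemma orbit_add b k q i j : orbit b k q (i + j) = orbit b (k + i) (orbit b k q i) j.
Proof. by elim: j => [|j IH]; rewrite ?addn0// addnS /= IH addnA. Qed.

Lemma visited_inf_shift b k q i r :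
  visited_inf b (k + i) (orbit b k q i) r <-> visited_inf b k q r.
Proof.
split=> v J.
  have [j Jj] := v J; rewrite -addnA -orbit_add => rj.
  by exists (i + j)%N => //; rewrite (leq_trans Jj) ?leq_addl.
have [j Jj rj] := v (i + J)%N; have ij := leq_trans (leq_addr _ _) Jj.
by exists (j - i)%N; [rewrite leq_subRL|rewrite -addnA -orbit_add subnKC].
Qed.

Lemma orbit_limsup_in_shift F b k q i :
  orbit_limsup_in F b (k + i) (orbit b k q i) <-> orbit_limsup_in F b k q.
Proof.
have E r := visited_inf_shift b k q i r.
by split=> -[r [rF /E io mx]]; exists r; split=> // r' /E; exact: mx.
Qed.

Hypothesis (lc : limited_choice A) (nll : NLL A).
Hypothesis (legT : forall n, legal_letter (t n) (T n)).

Lemma move_at_trans n q : (q, t n, move_at n q) \in trans A.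
Proof. exact: letter_move_trans. Qed.

Lemma visited_reach n q r : q \in reach n -> r \in visited (move_at n) q ->
  r \in reach n.
Proof.
move=> qn; rewrite inE => /iter_findex <-; elim: (findex _ _ _) => //= k IH.
rewrite {1}/local_step; case E: (move_at n _) => [r'|//].
apply: reach_local IH _; rewrite /local_move E eqxx.
by have := move_at_trans n (iter k (local_step (move_at n)) q); rewrite E; case: ifP.
Qed.

Lemma descend_entry n q c : q \in reach n ->
  descend (move_at n) c q \in entry (rcons n c).
Proof.
move=> qn; rewrite /descend.
have := split_stateP nll (move_at_trans n) q; rewrite /is_split.
case E : (move_at n _) => [//|[r0 r1]] _; apply: reach_split E.
by apply: visited_reach qn _; exact: split_state_visited.
Qed.

Lemma orbit_entry b k q j : q \in entry (mkseq b k) ->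
  orbit b k q j \in entry (mkseq b (k + j)).
Proof.
move=> qk; elim: j => [|j IH] /=; first by rewrite addn0.
by rewrite addnS mkseqS; apply: descend_entry; exact: entry_reach.
Qed.

Lemma visited_Fpos n q r : q \in Fpos A -> r \in visited (move_at n) q -> r \in Fpos A.
Proof.
move=> qF; rewrite inE => /iter_findex <-; elim: (findex _ _ _) => //= k IH.
rewrite {1}/local_step; case E: (move_at n _) => [r'|//].
by apply: (Fpos_local IH); rewrite -E; exact: move_at_trans.
Qed.

Lemma descend_Fpos n q : q \in Fpos A ->
  exists c, descend (move_at n) c q \in Fpos A.
Proof.
move=> qF; rewrite /descend.
have := split_stateP nll (move_at_trans n) q; rewrite /is_split.
case E : (move_at n _) => [//|[r0 r1]] _.
have sF : split_state (move_at n) q \in Fpos A.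
  by apply: visited_Fpos qF _; exact: split_state_visited.
have := Fpos_split sF (a := t n) (r0 := r0) (r1 := r1).
by rewrite -E move_at_trans => /(_ isT) /orP[]; [exists false|exists true].
Qed.

(** * Plays in which Adam follows [star], compared with orbits *)

Section StarPlay.
Context (b : branch).

Definition star_next (v : vertex Q) : vertex Q :=
  next (move_at v.1 v.2) v (b (size v.1)).

Lemma iter_star_local n q i :
  (forall j, (j < i)%N -> ~~ is_split (move_at n) (iter j (local_step (move_at n)) q)) ->
  iter i star_next (n, q) = (n, iter i (local_step (move_at n)) q).
Proof.
elim: i => // i IH nsp; rewrite iterS IH; last by move=> j ji; apply: nsp; rewrite ltnS ltnW.
have := nsp i (ltnSn _); rewrite /= /star_next /is_split /local_step /=.
by case: (move_at n _).
Qed.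

Lemma star_visits n q r : r \in visited (move_at n) q ->
  exists i, iter i star_next (n, q) = (n, r).
Proof. by case/visited_prefix => i <- nsp; exists i; rewrite iter_star_local. Qed.

Lemma star_descends n q : exists i, iter i.+1 star_next (n, q) =
  (rcons n (b (size n)), descend (move_at n) (b (size n)) q).
Proof.
have [i iE] := star_visits (split_state_visited (move_at n) q).
exists i; rewrite iterS iE /star_next /descend /=.
have := split_stateP nll (move_at_trans n) q; rewrite /is_split.
by case: (move_at n _) => [//|[r0 r1]].
Qed.

Lemma star_orbit k q j : exists2 i, (j <= i)%N &
  iter i star_next (mkseq b k, q) = (mkseq b (k + j), orbit b k q j).
Proof.
elim: j => [|j [i ji iE]]; first by exists 0%N => //=; rewrite addn0.
have [i' i'E] := star_descends (mkseq b (k + j)) (orbit b k q j).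
exists (i'.+1 + i)%N; first by rewrite addSn ltnS (leq_trans ji) ?leq_addl.
by rewrite iterD iE i'E size_mkseq addnS mkseqS.
Qed.

Lemma star_invariant k q i : exists j,
  (iter i star_next (mkseq b k, q)).1 = mkseq b (k + j) /\
  (iter i star_next (mkseq b k, q)).2 \in
    visited (move_at (mkseq b (k + j))) (orbit b k q j).
Proof.
elim: i => [|i [j [e1 e2]]] /=; first by exists 0%N; rewrite addn0 visited_refl.
move: e1 e2; case: (iter i _ _) => n r /= -> rv.
rewrite /star_next /= size_mkseq; case E : (move_at _ r) => [r'|[r0 r1]] /=.
  by exists j; split=> //; exact: visited_local rv E.
exists j.+1; rewrite addnS mkseqS; split=> //=.
have rsp : is_split (move_at (mkseq b (k + j))) r by rewrite /is_split E.
have := visited_split nll (move_at_trans _) rv rsp.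
by rewrite /descend => <-; rewrite E visited_refl.
Qed.

Lemma star_size_mono v i j : (i <= j)%N ->
  (size (iter i star_next v).1 <= size (iter j star_next v).1)%N.
Proof.
move=> /subnK <-; elim: (j - i)%N => // c IH; apply: leq_trans IH _.
by rewrite addSn iterS; apply: size_prefix; exact: next_prefix.
Qed.

Lemma star_inf_often k q r :
  inf_often ((fun i => iter i star_next (mkseq b k, q)) : play A) r <->
  visited_inf b k q r.
Proof.
split=> io J.
  have [i0 _ i0E] := star_orbit k q J.
  have [i ii0 iE] := io i0; have [j [jE rj]] := star_invariant k q i.
  exists j; last by rewrite -[r]iE.
  by have := star_size_mono (mkseq b k, q) ii0; rewrite i0E jE !size_mkseq leq_add2l.
have [j Jj rj] := io J; have [i ji iE] := star_orbit k q j.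
have [c cE] := star_visits rj.
by exists (c + i)%N; [rewrite (leq_trans Jj)// (leq_trans ji)// leq_addl|rewrite iterD iE cE].
Qed.

End StarPlay.

Lemma limsup_in_star F b k q :
  limsup_in F ((fun i => iter i (star_next b) (mkseq b k, q)) : play A) <->
  orbit_limsup_in F b k q.
Proof.
have E r := star_inf_often b k q r.
by split=> -[r [rF /E io mx]]; exists r; split=> // r' /E; exact: mx.
Qed.

End Tokens.

Lemma limsup_in_shift (S : finType) d (Q : finOrderType d) (A : nzaut S Q)
    F (rho rho' : play A) k : (forall i, rho (k + i)%N = rho' i) ->
  limsup_in F rho <-> limsup_in F rho'.
Proof.
move=> e; have io r : inf_often rho r <-> inf_often rho' r.
  split=> io N.
    have [i Ni iE] := io (k + N)%N; have ki := leq_trans (leq_addr _ _) Ni.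
    by exists (i - k)%N; [rewrite leq_subRL|rewrite -e subnKC].
  have [i Ni iE] := io N.
  by exists (k + i)%N; [rewrite (leq_trans Ni) ?leq_addl|rewrite e].
by split=> -[r [rF /io ior mx]]; exists r; split=> // r' /io/mx.
Qed.

(** * Plays eventually follow a token *)

Section Plays.
Context (S : finType) (d : Order.disp_t) (Q : finOrderType d) (A : nzaut S Q).
Context (t : tree S) (T : tree (strat_alphabet A)).
Hypothesis (lc : limited_choice A) (nll : NLL A).
Hypothesis (legT : forall n, legal_letter (t n) (T n)).
Context (sigma : strategy Q).
Hypothesis sigmaE : forall h n (u : {q | q \in eve A}), sigma h (n, val u) = T n u.

Local Notation mv := (move_at t T).
Local Notation entry := (entry t T).
Local Notation reach := (reach t T).
Local Notation star_next := (star_next t T).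
Local Notation orbit := (orbit t T).

Lemma eve_move h v : v.2 \in eve A -> sigma h v = mv v.1 v.2.
Proof.
case: v => n q /= qE; rewrite /move_at /letter_move.
by case: insubP => [u _ <-|]; [exact: sigmaE|rewrite qE].
Qed.

Lemma adam_star v : v.2 \notin eve A -> mv v.1 v.2 = inl (star A (t v.1) v.2).
Proof. by move=> qE; rewrite /move_at /letter_move insubN. Qed.

Lemma sigma_legal : legal A t (eve A) sigma.
Proof. by move=> h v vE; rewrite eve_move//; exact: move_at_trans. Qed.

Section AgainstTau.
Context (tau : strategy Q).
Hypothesis legtau : legal A t (adam A) tau.

Local Notation chosen := (chosen A sigma tau).

Lemma chosen_eve h v : v.2 \in eve A -> chosen h v = mv v.1 v.2.
Proof. by move=> vE; rewrite /Defs.chosen vE eve_move. Qed.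

Lemma chosen_trans h v : (v.2, t v.1, chosen h v) \in trans A.
Proof.
rewrite /Defs.chosen; case: ifPn => vE; first exact: sigma_legal.
by apply: legtau; rewrite finset.in_setC.
Qed.

Lemma chosen_adam h v : v.2 \notin eve A -> exists r, chosen h v = inl r.
Proof.
move=> vE; have [|loc _] := lc (q := v.2); first by rewrite finset.in_setC.
exact: loc (chosen_trans h v).
Qed.

Lemma chosen_edge h v c : edge A v.2 (next (chosen h v) v c).2.
Proof.
have := chosen_trans h v; case: (chosen h v) => [r|[r0 r1]] /= vr.
  by apply/existsP; exists (t v.1); rewrite vr.
apply/existsP; exists (t v.1); apply/orP; right; apply/existsP.
by case: c; [exists r0|exists r1]; rewrite vr ?orbT.
Qed.

Lemma chosen_reach h v c : v.2 \in reach v.1 ->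
  let w := next (chosen h v) v c in w.2 \in reach w.1.
Proof.
move=> vr /=; have := chosen_trans h v; have [vE|vA] := boolP (v.2 \in eve A).
  rewrite chosen_eve//; case E: (mv _ _) => [r|[r0 r1]] /= vr'.
    by apply: reach_local vr _; rewrite /local_move vE E.
  by apply: entry_reach; exact: reach_split vr E.
have [r ->] := chosen_adam h vA => /= vr'.
by apply: reach_local vr _; rewrite /local_move (negbTE vA).
Qed.

Lemma chosen_entry h v c : v.2 \in reach v.1 ->
  let w := next (chosen h v) v c in w.1 != v.1 -> w.2 \in entry w.1.
Proof.
move=> vr /=; have [vE|vA] := boolP (v.2 \in eve A).
  rewrite chosen_eve//; case E: (mv _ _) => [r|[r0 r1]] /=; rewrite ?eqxx// => _.
  exact: reach_split vr E.
by have [r ->] := chosen_adam h vA; rewrite eqxx.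
Qed.

Section AlongBranch.
Context (b : branch).

Local Notation rho := (play_of A sigma tau b).

Lemma play_of_reach i : (rho i).2 \in reach (rho i).1.
Proof.
elim: i => [|i IH]; last by rewrite play_ofS; exact: chosen_reach.
by apply: entry_reach; rewrite /start /= inE.
Qed.

Lemma play_of_size_mono i j : (i <= j)%N ->
  (size (rho i).1 <= size (rho j).1)%N.
Proof.
move=> /subnK <-; elim: (j - i)%N => // c IH; apply: leq_trans IH _.
by rewrite addSn play_ofS; apply: size_prefix; exact: next_prefix.
Qed.

(** (NLL) forbids staying at a node forever, and the step that leaves it is a split by Eve into the
    next node of [b]. *)
Lemma play_of_entry k : exists i,
  (rho i).1 = mkseq b k /\ (rho i).2 \in entry (mkseq b k).
Proof.
elim: k => [|k [i [e1 e2]]]; first by exists 0%N; rewrite inE.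
have : exists j, (rho (i + j.+1)%N).1 != mkseq b k.
  apply: contrapT => nex.
  have stays j : (rho (i + j)%N).1 = mkseq b k.
    case: j => [|j]; first by rewrite addn0.
    by apply/eqP/negPn/negP => ne; apply: nex; exists j.
  apply: (@local_chain_bounded _ _ _ A nll (t (mkseq b k))
    (fun j => (rho (i + j)%N).2)) => j _.
  have := stays j.+1; rewrite addnS play_ofS.
  have := chosen_trans (mkseq rho (i + j)%N) (rho (i + j)%N).
  rewrite (stays j); case: (chosen _ _) => [r|[r0 r1]] //= _.
  by rewrite (stays j) => /(congr1 size)/eqP; rewrite size_rcons (gtn_eqF (ltnSn _)).
move=> exj; case: (ex_minnP exj) => j jN mn.
have ij : (rho (i + j)%N).1 = mkseq b k.
  case: j jN mn => [|j] _ mn; first by rewrite addn0.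
  by apply/eqP/negPn/negP => ne; have := mn j ne; rewrite ltnn.
exists (i + j.+1)%N; move: jN; rewrite addnS play_ofS -ij => jN.
have := chosen_entry (play_of_reach (i + j)%N) jN; split; last first.
  move: jN H; rewrite ij.
  by case: (chosen _ _) => [r|[r0 r1]] /=; rewrite ?ij ?eqxx // size_mkseq mkseqS.
move: jN; case: (chosen _ _) => [r|[r0 r1]] /=; rewrite ?eqxx // => _.
by rewrite ij size_mkseq mkseqS.
Qed.

(** The number of reachable states never increases along a play. Once it is constant, every step
    stays in its strongly connected component, where limited choice leaves Adam no move but
    [star]. *)
Lemma play_of_eventually_star : exists N, forall i, (N <= i)%N ->
  rho i.+1 = star_next b (rho i).
Proof.
pose f i := #|[pred r | connect (edge A) (rho i).2 r]|.
have e i : edge A (rho i).2 (rho i.+1).2 by rewrite play_ofS; exact: chosen_edge.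
have fsub i : [pred r | connect (edge A) (rho i.+1).2 r] \subset
    [pred r | connect (edge A) (rho i).2 r].
  by apply/fintype.subsetP => r; rewrite !inE; apply: connect_trans; exact: connect1.
have [//|N _ fN] := @nonincreasing_stable f 0%N.
  by move=> i _; exact: fintype.subset_leq_card (fsub i).
exists N => i iN.
have /subset_cardP/(_ (fsub i)) eqf : f i.+1 = f i by rewrite !fN// leqW.
have scc : same_scc A (rho i).2 (rho i.+1).2.
  rewrite /same_scc connect1//=.
  by have := eqf (rho i).2; rewrite !inE connect0.
move: scc; rewrite play_ofS /star_next.
have [vE|vA] := boolP ((rho i).2 \in eve A); first by rewrite chosen_eve.
have [r rE] := chosen_adam (mkseq rho i) vA; rewrite rE /= => scc.
rewrite adam_star//= (starE lc vA _ scc)// -rE; exact: chosen_trans.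
Qed.

Lemma play_of_orbit : exists k q, q \in entry (mkseq b k) /\
  forall F, limsup_in F rho <-> orbit_limsup_in t T F b k q.
Proof.
have [N st] := play_of_eventually_star.
(* One level below the node of time [N], so that the play enters it after [N]. *)
pose k := (size (rho N).1).+1; have [i [e1 e2]] := play_of_entry k.
exists k, (rho i).2; split=> // F.
have iN : (N <= i)%N.
  rewrite leqNgt; apply/negP => /ltnW/play_of_size_mono.
  by rewrite e1 size_mkseq ltnn.
rewrite -limsup_in_star//; apply: (@limsup_in_shift _ _ _ A F rho _ i) => j.
elim: j => [|j IH]; first by rewrite addn0 /= -e1; case: (rho i).
by rewrite addnS iterS -IH st// (leq_trans iN)// leq_addr.
Qed.

End AlongBranch.
End AgainstTau.
End Plays.

(** * Winning strategies in terms of tokens *)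

Section ConsistentPlays.
Context (S : finType) (d : Order.disp_t) (Q : finOrderType d) (A : nzaut S Q).
Context (sigma tau : strategy Q).

Lemma consistent_from_last h v s w :
  consistent_from A sigma tau h v (rcons s w) -> prefix (last v s).1 w.1.
Proof.
elim: s h v => [|w' s IH] h v /=.
  by rewrite andbT => /existsP[c /eqP ->]; exact: next_prefix.
by case/andP=> _; exact: IH.
Qed.

Lemma consistent_branch (rho : play A) : consistent sigma tau rho ->
  exists b, rho = play_of A sigma tau b.
Proof.
move=> cs.
have pre i : prefix (rho i).1 (rho i.+1).1.
  have := cs i.+2; rewrite mkseqSl mkseqS /= => /andP[_ /consistent_from_last].
  by case: i => [|i] //; rewrite mkseqS last_rcons.
have prek i k : prefix (rho i).1 (rho (i + k)%N).1.
  elim: k => [|k IH]; first by rewrite addn0 prefix_refl.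
  by apply: prefix_trans IH _; rewrite addnS.
(* Bits beyond the depths reached by the play, if any, default to [false]. *)
pose b k := if pselect (exists i, (k < size (rho i).1)%N) is left e
  then nth false (rho (projT1 (cid e))).1 k else false.
have bE i : cone (rho i).1 b.
  rewrite /cone /=; apply: (@eq_from_nth _ false); first by rewrite size_mkseq.
  move=> k; rewrite size_mkseq => ki; rewrite nth_mkseq// /b.
  case: pselect => [e|]; last by case; exists i.
  case: (cid e) => j /= kj.
  have nthp n n' : prefix n n' -> (k < size n)%N -> nth false n k = nth false n' k.
    by move=> /prefixP[n2 ->] kn; rewrite nth_cat kn.
  case/orP: (leq_total i j) => ij.
    by apply/esym/nthp => //; rewrite -(subnKC ij).
  by apply: nthp => //; rewrite -(subnKC ij).
exists b; apply/funext => i.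
have : play_of A sigma tau b \in cylinder (A := A) (mkseq rho i.+1).
  rewrite play_of_cylinder cs mkseqS last_rcons /=; exact/mem_set.
move/set_mem; rewrite /cylinder /mkset size_mkseq !mkseqS.
by move=> /rcons_inj[_ ->].
Qed.

Definition play_stays (s : seq (vertex Q)) (v : vertex Q) : set branch := [set b | cone v.1 b /\
  forall i, (size s <= i)%N -> (play_of A sigma tau b i).2 \in Fpos A].

Lemma play_stays_preimage s v : fin_consistent A sigma tau (rcons s v) ->
  play_of A sigma tau @^-1` (cylinder (rcons s v) `&`
    [set rho : play A | forall i, (size s <= i)%N -> (rho i).2 \in Fpos A]) =
  play_stays s v.
Proof.
move=> cs; apply/seteqP; split => b /= [bs st]; split=> //.
  by move/mem_set: bs; rewrite play_of_cylinder cs last_rcons /= => /set_mem.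
by apply/set_mem; rewrite play_of_cylinder cs last_rcons /=; exact/mem_set.
Qed.

Lemma measurable_stays k (F : {set Q}) :
  measurable [set rho : plays A | forall i, (k <= i)%N -> (rho i).2 \in F].
Proof.
rewrite (_ : [set _ | _] = \bigcap_i
    [set rho : plays A | (k <= i)%N -> (rho i).2 \in F]).
  apply: bigcapT_measurable => i; case: leqP => ?.
    rewrite (_ : [set _ | _] = [set rho : plays A | (rho i).2 \in F]).
      exact: measurable_play_state.
    by apply/seteqP; split => rho /=; [apply|].
  by rewrite (_ : [set _ | _] = setT)//; apply/seteqP; split.
by apply/seteqP; split => rho /= H i; [move=> _|move=> ?]; apply: H.
Qed.

Lemma measurable_play_stays s v : fin_consistent A sigma tau (rcons s v) ->
  measurable (play_stays s v : set branches).
Proof.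
move=> cs; rewrite -play_stays_preimage// -[X in measurable X]setTI.
apply: (measurable_play_of (A := A)) => //; apply: measurableI.
  exact: measurable_cylinder.
exact: measurable_stays.
Qed.

Lemma play_measure_stays (R : realType) s v :
  fin_consistent A sigma tau (rcons s v) ->
  play_measure A R sigma tau (cylinder (rcons s v) `&`
    [set rho : play A | forall i, (size s <= i)%N -> (rho i).2 \in Fpos A]) =
  coin R (play_stays s v).
Proof.
move=> cs; rewrite -play_stays_preimage//; apply: play_measure_coin.
apply: measurableI; first exact: measurable_cylinder.
exact: measurable_stays.
Qed.

Lemma ae_limsup_coin (R : realType) F :
  {ae play_measure A R sigma tau, forall rho, limsup_in F (rho : play A)} <->
  {ae coin R, forall b, limsup_in F (play_of A sigma tau b)}.
Proof.
have mL := measurableC (measurable_limsup_in (A := A) F).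
have mL' := measurable_play_of (A := A) sigma tau measurableT mL.
rewrite setTI in mL'.
have E := play_measure_coin R sigma tau mL.
by split=> /(negligibleP _) H; apply/negligibleP => //;
  [exact: etrans (esym E) (H mL)|exact: etrans E (H mL')].
Qed.

End ConsistentPlays.

(** * Eliminating Adam's strategies from the winning condition *)

Section WinningTokens.
Context (S : finType) (d : Order.disp_t) (Q : finOrderType d) (A : nzaut S Q).
Context (t : tree S) (T : tree (strat_alphabet A)).
Hypothesis (lc : limited_choice A) (nll : NLL A).
Hypothesis (legT : forall n, legal_letter (t n) (T n)).
Context (sigma : strategy Q).
Hypothesis sigmaE : forall h n (u : {q | q \in eve A}), sigma h (n, val u) = T n u.

Local Notation mv := (move_at t T).
Local Notation entry := (entry t T).
Local Notation reach := (reach t T).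
Local Notation star_next := (star_next t T).
Local Notation orbit := (orbit t T).

(* Adam replays the finite play [s] as long as he can, and plays [star] afterwards. *)
Definition follow (s : seq (vertex Q)) : strategy Q := fun h v =>
  let w := nth v s (size h).+1 in
  if [&& ((size h).+1 < size s)%N, take (size h).+1 s == rcons h v
       & (v.2, t v.1, inl w.2) \in trans A]
  then inl w.2 else inl (star A (t v.1) v.2).

Lemma follow_legal s : legal A t (adam A) (follow s).
Proof.
move=> h v; rewrite /follow finset.in_setC => vA.
by case: ifP => [/and3P[]//|_]; exact: star_trans.
Qed.

Definition move_step (v w : vertex Q) : Prop := exists m c,
  [/\ v.2 \in eve A -> m = mv v.1 v.2, (v.2, t v.1, m) \in trans A &
      w = next m v c].

Fixpoint move_path v s : Prop :=
  if s is w :: s' then move_step v w /\ move_path w s' else True.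

Lemma move_path_rcons v s w :
  move_path v s -> move_step (last v s) w -> move_path v (rcons s w).
Proof. by elim: s v => [|w' s IH] v //= [? /IH{}IH] /IH. Qed.

(** Every reachable state ends a finite play that [follow] can replay. This turns a condition on all
    strategies of Adam into one on all tokens. *)
Lemma reach_move_path n q : q \in reach n ->
  exists s, move_path (start A) s /\ last (start A) s = (n, q).
Proof.
have close m : (forall p, p \in entry m ->
    exists s, move_path (start A) s /\ last (start A) s = (m, p)) ->
  forall p, p \in reach m ->
    exists s, move_path (start A) s /\ last (start A) s = (m, p).
  move=> H p; rewrite inE => /existsP[p0 /andP[/H[s [ps ls]] /connectP[c pc ->]]].
  elim/last_ind: c pc => [|c r IH]; first by exists s.
  rewrite rcons_path last_rcons => /andP[/IH[s' [ps' ls']] lm].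
  exists (rcons s' (m, r)); rewrite last_rcons; split=> //.
  apply: move_path_rcons => //; rewrite ls'; exists (inl r), true; split=> //=.
    by move: lm; rewrite /local_move => + E; rewrite E => /eqP ->.
  move: lm; rewrite /local_move; case: ifP => // _ /eqP <-.
  exact: (move_at_trans lc legT).
move: n q; elim/last_ind => [|n c IH]; apply: close => q.
  by rewrite inE => /eqP ->; exists [::].
rewrite entry_rcons inE => /existsP[p /and3P[/IH[s [ps ls]] pE]].
case E : (mv n p) => [//|[r0 r1]] /eqP ->.
exists (rcons s (rcons n c, if c then r1 else r0)); rewrite last_rcons; split=> //.
apply: move_path_rcons => //; rewrite ls; exists (mv n p), c.
by split=> //=; [exact: (move_at_trans lc legT)|rewrite E].
Qed.

Lemma follow_consistent s : move_path (start A) s ->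
  fin_consistent A sigma (follow (start A :: s)) (start A :: s).
Proof.
rewrite /= eqxx /=.
have : [::] ++ start A :: s = start A :: s by [].
move: {-1}(start A :: s) (Nil (vertex Q)) => s1.
elim: s (start A) => [|w s IH] v h //= e [[m [c [mE mT wE]]] ps].
apply/andP; split; last by apply: (IH w (rcons h v)) ps; rewrite cat_rcons.
apply/existsP; exists c; rewrite wE /chosen; case: ifPn => vE.
  by rewrite (eve_move t sigmaE)// mE.
have [|loc _] := lc (q := v.2); first by rewrite finset.in_setC.
have [r mr] := loc _ _ mT; rewrite mr /=.
have -> : follow s1 h v = inl r; last by [].
rewrite /follow -e.
have -> : nth v (h ++ v :: w :: s) (size h).+1 = w.
  by rewrite nth_cat ltnNge leqnSn /= subSnn.
rewrite size_cat /= addnS ltnS addnS ltnS leq_addr /=.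
have -> : take (size h).+1 (h ++ v :: w :: s) = rcons h v.
  by rewrite -cat_rcons take_size_cat// size_rcons.
by rewrite eqxx wE mr /= -mr mT.
Qed.

Lemma play_of_follow s n q b : move_path (start A) s ->
  last (start A) s = (n, q) -> cone n b ->
  forall j, play_of A sigma (follow (start A :: s)) b (size s + j)%N =
            iter j (star_next b) (n, q).
Proof.
move=> ps ls nb; set tau := follow _.
have : play_of A sigma tau b \in cylinder (A := A) (start A :: s).
  by rewrite play_of_cylinder follow_consistent//= ls; exact/mem_set.
move/set_mem; rewrite /cylinder /mkset -[size (_ :: s)]/(size s).+1 => e.
elim => [|j IH].
  have := congr1 (last (start A)) e; rewrite mkseqS last_rcons /= ls addn0.
  by [].
rewrite addnS play_ofS IH iterS /star_next.
congr (next _ _ _); rewrite /chosen.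
case: ifPn => vE; first by rewrite (eve_move t sigmaE).
by rewrite (adam_star _ _ vE)// /tau /follow size_mkseq /= !ltnS ltnNge leq_addr.
Qed.

Lemma limsup_in_follow s n q b F : move_path (start A) s ->
  last (start A) s = (n, q) -> cone n b ->
  limsup_in F (play_of A sigma (follow (start A :: s)) b) <->
  orbit_limsup_in t T F b (size n) q.
Proof.
move=> ps ls nb; rewrite -limsup_in_star//.
apply: (@limsup_in_shift _ _ _ A F _ _ (size s)) => i.
by rewrite (play_of_follow ps ls nb) nb.
Qed.

Lemma stay_rcons n c q b : cone (rcons n c) b -> q \in Fpos A ->
  stay t T (rcons n c) (descend (mv n) c q) b -> stay t T n q b.
Proof.
move=> /cone_rcons[nb bc] qF [_ st]; split=> // -[|j] //.
by rewrite orbitSl nb bc; have := st j; rewrite size_rcons.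
Qed.

(** The [j]-th state of an orbit depends on the first [size n + j] bits only. *)
Lemma measurable_stay n q : measurable (stay t T n q : set branches).
Proof.
rewrite (_ : stay t T n q = cone n `&` \bigcap_j
    [set b : branches | orbit b (size n) q j \in Fpos A]).
  apply: measurableI; first exact: measurable_cone.
  apply: bigcapT_measurable => j.
  pose P (s : node) : Prop := orbit (fun i => nth false s i) (size n) q j \in Fpos A.
  rewrite (_ : [set _ | _] = [set b : branches | P (mkseq b (size n + j))]).
    exact: (measurable_branch_prefix (size n + j) P).
  apply/eq_set => b; rewrite /P.
  suff -> : orbit b (size n) q j =
    orbit (fun i => nth false (mkseq b (size n + j)) i) (size n) q j by [].
  by apply: orbit_ext => i ij; rewrite nth_mkseq.
by apply/seteqP; split => b /= [nb st]; split=> // j; [move=> _|]; exact: st.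
Qed.

Context (R : realType).

Definition tokens_win : Prop :=
  [/\ forall b k q, q \in entry (mkseq b k) ->
        orbit_limsup_in t T (Fall A) b k q,
      {ae coin R, forall b, forall k q, q \in entry (mkseq b k) ->
        orbit_limsup_in t T (Fone A) b k q} &
      forall n q, q \in entry n -> q \in Fpos A -> (0 < coin R (stay t T n q))%E].

Lemma winning_tokens : winning A R t sigma -> tokens_win.
Proof.
move=> [_ W]; split.
- move=> b k q /entry_reach/reach_move_path[s [ps ls]].
  have [sure _ _] := W _ (follow_legal (start A :: s)).
  have := sure _ (@consistent_play_of _ _ _ A sigma _ b).
  by move/(limsup_in_follow _ ps ls (cone_mkseq b k)); rewrite size_mkseq.
- have {}W (s : seq (vertex Q)) :
    {ae coin R, forall b, limsup_in (Fone A) (play_of A sigma (follow (start A :: s)) b)}.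
    by have [_ as_ _] := W _ (follow_legal (start A :: s)); exact/ae_limsup_coin.
  (* One null set serves all finite plays [s], which are countably many. *)
  have {W}/ae_coin_forall-/(_ pickle (fun i => odflt [::] (unpickle i))) W := W.
  apply: ae_coin_imply (W _) => [b {}W k q /entry_reach/reach_move_path[s [ps ls]]|s].
    have := W s.
    by move/(limsup_in_follow _ ps ls (cone_mkseq b k)); rewrite size_mkseq.
  by rewrite pickleK.
- move=> n q /entry_reach/reach_move_path[s [ps ls]] qF.
  have [_ _ pos] := W _ (follow_legal (start A :: s)).
  have sE : start A :: s = rcons (belast (start A) s) (n, q) by rewrite -ls lastI.
  have := pos (belast (start A) s) (n, q).
  have cs := follow_consistent ps; rewrite sE in cs *.
  rewrite play_measure_stays// => /(_ cs qF) /lt_le_trans; apply.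
  apply: le_measure; rewrite ?inE.
  + exact: measurable_play_stays.
  + exact: measurable_stay.
  + move=> b /= [nb st]; split=> // j; move: st; rewrite -sE size_belast => st.
    have [i ji iE] := star_orbit lc nll legT b (size n) q j.
    have := st (size s + i)%N; rewrite leq_addr (play_of_follow ps ls nb).
    by move: iE; rewrite nb => ->; apply.
Qed.

(** Induction on the number of reachable states. If the event were null, so would be its part after
    any entry into a smaller component, against the induction hypothesis; hence Adam plays [star] as
    long as the play is in [Fpos A], and the event contains that of a token. *)
Lemma tokens_win_stays tau s v : tokens_win -> legal A t (adam A) tau ->
  fin_consistent A sigma tau (rcons s v) -> v.2 \in Fpos A ->
  (0 < coin R (play_stays A sigma tau s v))%E.
Proof.
move=> [_ _ pos] legtau.
pose below q := #|[pred r | connect (edge A) q r]|.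
have [c] := ubnP (below v.2); elim: c s v => // c IH s v; rewrite ltnS => vc cs vF.
rewrite lt0e measure_ge0 andbT; apply/negP => /eqP null.
have cyl b : cone v.1 b -> mkseq (play_of A sigma tau b) (size s).+1 = rcons s v.
  move=> vb; have : play_of A sigma tau b \in cylinder (A := A) (rcons s v).
    by rewrite play_of_cylinder cs last_rcons; exact/mem_set.
  by move/set_mem; rewrite /cylinder /mkset size_rcons.
have at_s b : cone v.1 b -> play_of A sigma tau b (size s) = v.
  by move=> /cyl; rewrite mkseqS => /rcons_inj[].
(* Since [play_stays s v] is null, a strictly smaller component cannot be
   entered without leaving [Fpos]. *)
have same b i : cone v.1 b -> (size s <= i)%N ->
    (forall j, (size s <= j <= i)%N -> (play_of A sigma tau b j).2 \in Fpos A) ->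
    (below v.2 <= below (play_of A sigma tau b i).2)%N.
  move=> vb si st; rewrite leqNgt; apply/negP => lt.
  have := IH (mkseq (play_of A sigma tau b) i) _ (leq_trans lt vc).
  rewrite -mkseqS fin_consistent_play_of st ?si ?leqnn// => /(_ isT isT).
  apply/negP; rewrite -leNgt -null; apply: le_measure; rewrite ?inE.
  - by apply: measurable_play_stays; rewrite -mkseqS fin_consistent_play_of.
  - exact: measurable_play_stays.
  - move=> b' [b'i st']; rewrite size_mkseq in st'.
    have agree : mkseq (play_of A sigma tau b') i.+1 = mkseq (play_of A sigma tau b) i.+1.
      have : play_of A sigma tau b' \in
          cylinder (A := A) (mkseq (play_of A sigma tau b) i.+1).
        by rewrite play_of_cylinder fin_consistent_play_of mkseqS last_rcons; exact/mem_set.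
      by move/set_mem; rewrite /cylinder /mkset size_mkseq.
    have agreej j : (j <= i)%N -> play_of A sigma tau b' j = play_of A sigma tau b j.
      move=> ji; have := congr1 (fun s => nth (start A) s j) agree.
      by rewrite /= !nth_mkseq.
    split=> [|j sj].
      by rewrite -(at_s _ vb) -(agreej _ si); exact: play_of_cone.
    have [ji|/ltnW ij] := leqP j i; last exact: st'.
    by rewrite agreej// st// sj.
have starE b i : cone v.1 b -> (size s <= i)%N ->
    (forall j, (size s <= j <= i)%N -> (play_of A sigma tau b j).2 \in Fpos A) ->
    play_of A sigma tau b i.+1 = star_next b (play_of A sigma tau b i).
  move=> vb si st; rewrite play_ofS /star_next.
  set w := play_of A sigma tau b i; set h := mkseq _ i.
  have [wE|wA] := boolP (w.2 \in eve A); first by rewrite (chosen_eve t sigmaE).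
  have [r rE] := chosen_adam lc legT sigmaE legtau h wA.
  have wr := chosen_trans lc legT sigmaE legtau h w; rewrite rE in wr *.
  have wF : w.2 \in Fpos A by apply: st; rewrite si leqnn.
  have iS : play_of A sigma tau b i.+1 = (w.1, r) by rewrite play_ofS -/w -/h rE.
  have rF : r \in Fpos A by exact: Fpos_local wF wr.
  have le : (below v.2 <= below r)%N.
    have := same b i.+1 vb (leqW si); rewrite iS /=; apply => j /andP[sj].
    rewrite leq_eqVlt => /orP[/eqP ->|ji]; first by rewrite iS.
    by apply: st; rewrite sj.
  have wv : connect (edge A) v.2 w.2.
    rewrite -(at_s _ vb) /w -(subnKC si); elim: (i - size s)%N => [|k IHk].
      by rewrite addn0 connect0.
    apply: connect_trans IHk (connect1 _); rewrite addnS play_ofS.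
    exact: (chosen_edge lc legT sigmaE legtau).
  have wr1 : edge A w.2 r.
    by have := chosen_edge lc legT sigmaE legtau h w true; rewrite rE.
  have sub : [pred r' | connect (edge A) r r'] \subset [pred r' | connect (edge A) v.2 r'].
    apply/fintype.subsetP => r'; rewrite !inE; apply: connect_trans.
    exact: connect_trans wv (connect1 wr1).
  have eqb : #|[pred r' | connect (edge A) r r']| = #|[pred r' | connect (edge A) v.2 r']|.
    by apply/eqP; rewrite eqn_leq fintype.subset_leq_card//=.
  have scc : same_scc A w.2 r.
    rewrite /same_scc connect1//=.
    have := subset_cardP eqb sub w.2; rewrite !inE wv => ->.
    by [].
  by rewrite (adam_star t T wA) /= (@starE _ _ _ A lc _ _ _ wA wr scc).
have [b0 vb0] : exists b0, cone v.1 b0.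
  by exists (fun i => nth false v.1 i); rewrite /cone /= mkseq_nth.
have vreach : v.2 \in reach v.1.
  by rewrite -(at_s _ vb0); exact: (play_of_reach lc legT sigmaE legtau).
(* [pos] speaks of states that enter a node, so the token is followed down to a child where it still
   is in [Fpos A]. *)
have [e eF] := descend_Fpos lc nll legT v.1 vF.
have := pos (rcons v.1 e) _ (descend_entry lc nll legT e vreach) eF.
apply/negP; rewrite -leNgt -null; apply: le_measure; rewrite ?inE.
- exact: measurable_stay.
- exact: measurable_play_stays.
move=> b st; have vb : cone v.1 b by case: st => /cone_rcons[].
have {}st := stay_rcons (proj1 st) vF st.
have starF i : (iter i (star_next b) v).2 \in Fpos A.
  have vE : v = (mkseq b (size v.1), v.2) by rewrite vb; case: (v).
  have [j [_ jv]] := star_invariant lc nll legT b (size v.1) v.2 i.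
  rewrite vE; apply: (visited_Fpos lc legT) jv; exact: (proj2 st).
(* [starE] asks all states so far to be in [Fpos A]; they are, because by induction they agree with
   the star play. *)
have follows i : play_of A sigma tau b (size s + i)%N = iter i (star_next b) v.
  elim/ltn_ind: i => -[|i] IHi; first by rewrite addn0 at_s.
  rewrite addnS iterS -(IHi i)//; apply: starE => //; first exact: leq_addr.
  move=> j /andP[sj ji]; rewrite -(subnKC sj) IHi; first exact: starF.
  by rewrite ltnS leq_subLR.
by split=> // i si; rewrite -(subnKC si) follows.
Qed.

Lemma tokens_winning : tokens_win -> winning A R t sigma.
Proof.
move=> W; have [sure as_ pos] := W; split; first exact: (sigma_legal lc legT sigmaE).
move=> tau legtau; split.
- move=> rho /consistent_branch[b ->].
  have [k [q [qk ->]]] := play_of_orbit lc nll legT sigmaE legtau b.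
  exact: sure.
- apply/ae_limsup_coin; apply: ae_coin_imply as_ => b as_.
  have [k [q [qk ->]]] := play_of_orbit lc nll legT sigmaE legtau b.
  exact: as_.
- by move=> s v cs vF; rewrite play_measure_stays//; exact: tokens_win_stays.
Qed.

End WinningTokens.

(** * Latest appearance records *)

(* A latest appearance record, kept as a relation: [(c, c')] belongs to it when
   [c] was visited at least as recently as [c']. *)
Section Records.
Context (C : finType).
Implicit Types (V : {set C}) (R : {set C * C}).

Definition record_update V R : {set C * C} :=
  [set p | (p.1 \in V) || ((p.2 \notin V) && (p \in R))]%SET.

(** The segment of the record down to the oldest colour visited now. Its size yields the
    priority. *)
Definition record_hit V R : {set C} :=
  (V :|: [set c | [exists v in V, (c, v) \in R]])%SET.

Lemma record_hit0 R : record_hit finset.set0 R = finset.set0.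
Proof.
apply/setP => c; rewrite !inE /=; apply/negbTE/existsPn => v.
by rewrite finset.in_set0.
Qed.

Context (V : nat -> {set C}) (R : nat -> {set C * C}).
Hypothesis RS : forall k, R k.+1 = record_update (V k) (R k).

Definition visited_io : {set C} :=
  [set c | `[< forall N, exists2 k, (N <= k)%N & c \in V k >]]%SET.

Lemma visited_ioP c : c \in visited_io <-> forall N, exists2 k, (N <= k)%N & c \in V k.
Proof. by rewrite inE; split => /asboolP. Qed.

Lemma not_visited_io : exists N, forall k c, (N <= k)%N -> c \in V k -> c \in visited_io.
Proof.
have ex c : exists N, forall k, (N <= k)%N -> c \in V k -> c \in visited_io.
  have [cI|cI] := boolP (c \in visited_io); first by exists 0%N.
  apply: contrapT => nex; move/negP: cI; apply; apply/visited_ioP => N.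
  apply: contrapT => nk; apply: nex; exists N => k Nk ck.
  by case: nk; exists k.
have [f fP] := choice ex; exists (\max_c f c)%N => k c fk; apply: fP.
exact: leq_trans (leq_bigmax _) fk.
Qed.

(** Once only recurring colours are visited and each of them has been visited anew, the other
    colours are strictly older than all of them. *)
Lemma record_hit_sub : exists N, forall k, (N <= k)%N ->
  record_hit (V k) (R k) \subset visited_io.
Proof.
have [N1 N1P] := not_visited_io.
have ex v : exists N, v \in visited_io -> forall k, (N <= k)%N ->
    forall c, c \notin visited_io -> (c, v) \notin R k.
  have [vI|] := boolP (v \in visited_io); last by exists 0%N.
  have [k0 k0N vk0] := (visited_ioP v).1 vI N1.
  exists k0.+1 => _ k k0k c cI; rewrite -(subnKC k0k).
  have cV k' : (N1 <= k')%N -> c \notin V k' by move=> k'N; apply: contra cI; exact: N1P.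
  elim: (k - k0.+1)%N => [|j IH]; first by rewrite addn0 RS inE /= vk0 (negbTE (cV _ k0N)).
  rewrite addnS RS inE /= (negbTE (cV _ _)) ?(negbTE IH) ?andbF//.
  by rewrite (leq_trans k0N)// addSn ltnW// ltnS leq_addr.
have [f fP] := choice ex.
exists (maxn N1 (\max_v f v))%N => k; rewrite geq_max => /andP[kN1 kf].
apply/fintype.subsetP => c; rewrite inE => /orP[|]; first exact: N1P.
rewrite inE => /existsP[v /andP[vV cv]]; apply: contraTT cv.
by apply: (fP v); [exact: N1P vV|exact: leq_trans (leq_bigmax _) kf].
Qed.

(** When the last of the recurring colours returns after time [N], all the others have returned
    already and are at least as recent. *)
Lemma sub_record_hit N c0 : c0 \in visited_io ->
  exists2 k, (N <= k)%N & visited_io \subset record_hit (V k) (R k).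
Proof.
move=> c0I.
have ex c : exists k, c \in visited_io -> [/\ (N <= k)%N, c \in V k &
    forall j, (N <= j < k)%N -> c \notin V j].
  have [cI|] := boolP (c \in visited_io); last by exists 0%N.
  have [k Nk ck] := (visited_ioP c).1 cI N.
  have exk : exists k, (N <= k)%N && (c \in V k) by exists k; rewrite Nk.
  case: (ex_minnP exk) => k' /andP[Nk' ck'] mn; exists k' => _; split=> // j /andP[Nj jk'].
  by apply/negP => cj; have := mn j; rewrite Nj cj leqNgt jk' => /(_ isT).
have [f fP] := choice ex.
(* the colour of [visited_io] whose next visit is the latest *)
case: (@arg_maxnP _ c0 (mem visited_io) f c0I) => c cI cmax.
have [Nc cV cfirst] := fP c cI.
exists (f c) => //; apply/fintype.subsetP => c' c'I.
have [Nc' c'V _] := fP c' c'I.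
have cm : (f c' <= f c)%N := cmax c' c'I.
move: cm; rewrite leq_eqVlt => /orP[/eqP e|lt]; first by rewrite inE -e c'V.
rewrite !inE; apply/orP; right; apply/existsP; exists c; rewrite cV /=.
have : forall k, (f c' < k <= f c)%N -> (c', c) \in R k; last by apply; rewrite lt leqnn.
elim=> // k IH; rewrite ltnS => /andP[]; rewrite leq_eqVlt RS inE => /orP[/eqP <-|fk] kf.
  by rewrite c'V.
by rewrite cfirst ?IH ?fk ?(ltnW kf) ?orbT// kf (leq_trans Nc')// ltnW.
Qed.

End Records.

(** * Slots and runs *)

Lemma io_pigeonhole (X : finType) (P : nat -> Prop) (f : nat -> X) :
  (forall N, exists2 k, (N <= k)%N & P k) ->
  exists x, forall N, exists k, [/\ (N <= k)%N, P k & f k = x].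
Proof.
move=> io; pose V k := [set x | `[< P k /\ f k = x >]]%SET.
have [N NP] := not_visited_io V; have [k Nk Pk] := io N.
have /visited_ioP fk : f k \in visited_io V.
  by apply: NP Nk _; rewrite inE; apply/asboolP.
exists (f k) => M; have [j Mj] := fk M.
by rewrite inE => /asboolP[Pj fj]; exists j.
Qed.

Section States.
Context (Q : finType).

(* Slots are numbers below [#|Q|]; [(i, None)] signals that the token held by
   slot [i] changed, and [(i, Some q)] that this token visited [q]. *)
Definition color : finType := ('I_#|Q| * option Q)%type.

Definition bstate : finType := ({set Q} * {ffun Q -> 'I_#|Q|} * option Q *
  {set Q} * {set color} * {set color * color} * {set color})%type.

Implicit Type x : bstate.
Definition b_entry x : {set Q} := x.1.1.1.1.1.1.
Definition b_rank x : {ffun Q -> 'I_#|Q|} := x.1.1.1.1.1.2.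
Definition b_track x : option Q := x.1.1.1.1.2.
Definition b_owe x : {set Q} := x.1.1.1.2.
Definition b_acc x : {set color} := x.1.1.2.
Definition b_rec x : {set color * color} := x.1.2.
(** Stored in the state because acceptance looks at states and not at steps. *)
Definition b_hit x : {set color} := x.2.

(** A slot emits [None] when it is empty or when its token moves to another slot. *)
Definition colors (m : Q -> move Q) c (E : {set Q}) (r r' : {ffun Q -> 'I_#|Q|}) :
    {set color} :=
  [set u | if u.2 is Some q then [exists x in E, (r x == u.1) && (q \in visited m x)]
           else ~~ [exists x in E, (r x == u.1) && (r' (descend m c x) == u.1)]]%SET.

End States.

(** Meant for the set of recurring colours: where [None] does not recur, the slot eventually holds
    one token, and the largest recurring state is the limsup of that token. *)
Definition slots_ok d (Q : finOrderType d) (F : {set Q}) (I : {set color Q}) : bool :=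
  [forall i, forall q, [&& (i, None) \notin I, (i, Some q) \in I &
     [forall r, ((i, Some r) \in I) ==> (r <= q)%O]] ==> (q \in F)].

Section Steps.
Context (S : finType) (d : Order.disp_t) (Q : finOrderType d) (A : nzaut S Q).
Context (a : S) (dir : Q -> bool) (l : strat_alphabet A) (x : bstate Q) (c : bool).

Local Notation m := (letter_move a l).

(** The tracked token counts as served and leaves the debt; a token walking to the other child is
    owed there. *)
Definition next_owed : {set Q} :=
  [set descend m c q | q in [set q in b_owe x | (b_track x != Some q) && (dir q == c)]]%SET.

Definition step_colors r' : {set color Q} :=
  (b_acc x :|: colors m c (b_entry x) (b_rank x) r')%SET.

(** Colours are released at breakpoints only. Elsewhere nothing is recorded, so one priority can
    express both the recurrence of breakpoints and the limsup condition. *)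
Definition step_record r' : {set color Q} :=
  if next_owed == finset.set0 then step_colors r' else finset.set0.

(** A relation and not a function: the new ranks and the tracked token are guessed, and these
    determine the rest. *)
Record run_step (k : nat) (y : bstate Q) : Prop := RunStep {
  step_inj : injective (b_rank y);
  step_rank : forall q, q \in b_entry x ->
    (b_rank y (descend m c q) <= b_rank x q)%N;
  step_entry : b_entry y = next_entry A a m c (b_entry x);
  step_track : forall q', b_track y = Some q' ->
    [/\ q' \in b_entry y, q' \in Fpos A &
      forall q, b_track x = Some q -> q' = descend m c q];
  step_owe : b_owe y =
    if next_owed == finset.set0 then (b_entry y :&: Fpos A)%SET else next_owed;
  step_acc : b_acc y =
    if next_owed == finset.set0 then finset.set0 else step_colors (b_rank y);
  step_rec : b_rec y = record_update (step_record (b_rank y)) (b_rec x);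
  step_hit : b_hit y = record_hit (step_record (b_rank y)) (b_rec x);
  step_key : k = if next_owed == finset.set0 then #|b_hit y|.+1 else 0%N
}.

End Steps.

(** * What the slots of a run see along a branch *)

Section Runs.
Context (S : finType) (d : Order.disp_t) (Q : finOrderType d) (A : nzaut S Q).
Hypothesis (lc : limited_choice A) (nll : NLL A).
Context (t : tree S) (T : tree (strat_alphabet A)) (dir : node -> Q -> bool).
Hypothesis (legT : forall n, legal_letter (t n) (T n)).
Context (key : node -> nat) (st : node -> bstate Q).
Hypothesis st0_entry : b_entry (st [::]) = [set init A]%SET.
Hypothesis st0_rank : injective (b_rank (st [::])).
Hypothesis st0_acc : b_acc (st [::]) = finset.set0.
Hypothesis stS : forall n c,
  run_step (t n) (dir n) (T n) (st n) c (key (rcons n c)) (st (rcons n c)).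

Local Notation mv := (move_at t T).

Lemma run_entry n : b_entry (st n) = entry t T n.
Proof.
by elim/last_ind: n => // n c IH; rewrite (step_entry (stS n c)) entry_rcons IH.
Qed.

Lemma run_rank_inj n : injective (b_rank (st n)).
Proof. by elim/last_ind: n => // n c IH; exact: (step_inj (stS n c)). Qed.

Section RunBranch.
Context (b : branch).

Local Notation bk k := (mkseq b k).
Local Notation rk k := (b_rank (st (bk k))).
Local Notation flag k := (next_owed (t (bk k)) (dir (bk k)) (T (bk k)) (st (bk k)) (b k) == finset.set0).

Definition branch_colors k : {set color Q} :=
  colors (mv (bk k)) (b k) (entry t T (bk k)) (rk k) (rk k.+1).

Definition branch_record k : {set color Q} :=
  step_record (t (bk k)) (dir (bk k)) (T (bk k)) (st (bk k)) (b k) (rk k.+1).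

Lemma branch_step k : run_step (t (bk k)) (dir (bk k)) (T (bk k)) (st (bk k)) (b k)
  (key (bk k.+1)) (st (bk k.+1)).
Proof. by rewrite mkseqS; exact: stS. Qed.

Lemma flag_key k : flag k = (0 < key (bk k.+1))%N.
Proof. by rewrite (step_key (branch_step k)); case: ifP. Qed.

(** Waiting in [b_acc] until the next breakpoint delays a colour but neither loses nor invents one,
    provided breakpoints recur. *)
Lemma branch_record_io : (forall N, exists2 k, (N <= k)%N & flag k) ->
  visited_io branch_record = visited_io branch_colors.
Proof.
move=> io.
have acc_col k u : u \in b_acc (st (bk k)) -> exists i, [/\ (i < k)%N,
    u \in branch_colors i & forall j, (i <= j < k)%N -> ~~ flag j].
  elim: k => [|k IH]; first by rewrite st0_acc finset.in_set0.
  rewrite (step_acc (branch_step k)); case: ifPn => [|nf].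
    by rewrite finset.in_set0.
  rewrite inE => /orP[/IH[i [ik ui nfl]]|uk].
    exists i; rewrite ltnW//; split=> // j /andP[ij]; rewrite ltnS leq_eqVlt.
    by case/orP=> [/eqP -> //|jk]; apply: nfl; rewrite ij.
  exists k; split=> //; first by rewrite /branch_colors -run_entry.
  by move=> j; rewrite ltnS -eqn_leq => /eqP <-.
have col_acc k u i : u \in branch_colors i -> (i < k)%N ->
    (forall j, (i <= j < k)%N -> ~~ flag j) -> u \in b_acc (st (bk k)).
  move=> ui; elim: k => // k IH; rewrite ltnS leq_eqVlt => ik nfl.
  rewrite (step_acc (branch_step k)) ifN; last by apply: nfl; rewrite leq_eqVlt ik ltnSn.
  rewrite inE; case/orP: ik => [/eqP ik|ik].
    by rewrite run_entry; move: ui; rewrite /branch_colors ik => ->; rewrite orbT.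
  by rewrite IH// => j /andP[ij jk]; apply: nfl; rewrite ij ltnW.
apply/setP => u; apply/idP/idP => /visited_ioP uio; apply/visited_ioP => N.
  have [k0 Nk0 fk0] := io N; have [k k0k] := uio k0.+1.
  rewrite /branch_record /step_record; case: ifP => [fk|_]; last by rewrite finset.in_set0.
  rewrite inE => /orP[/acc_col[i [ik ui nfl]]|]; last first.
    by rewrite run_entry => uk; exists k => //; rewrite (leq_trans Nk0)// ltnW.
  exists i => //; rewrite (leq_trans Nk0)// leqNgt; apply/negP => ik0.
  by have := nfl k0; rewrite (ltnW ik0) k0k fk0 => /(_ isT).
have [i Ni ui] := uio N.
have exk : exists k, (i <= k)%N && flag k by have [k ? ?] := io i; exists k; apply/andP.
case: (ex_minnP exk) => k /andP[ik fk] mn; exists k; first exact: leq_trans ik.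
rewrite /branch_record /step_record fk inE.
move: ik; rewrite leq_eqVlt => /orP[/eqP ik|ik].
  by apply/orP; right; rewrite run_entry -ik.
rewrite (@col_acc k u i)// => j /andP[ij jk]; apply/negP => fj.
by have := mn j; rewrite ij fj leqNgt jk => /(_ isT).
Qed.

Lemma branch_colors_inl k q i : q \in entry t T (bk k) -> rk k q = i ->
  forall r, ((i, Some r) \in branch_colors k) = (r \in visited (mv (bk k)) q).
Proof.
move=> qk qi r; rewrite inE /=; apply/existsP/idP => [[q' /and3P[_ /eqP q'i]]|rq].
  by move: q'i; rewrite -qi => /run_rank_inj ->.
by exists q; rewrite qk qi eqxx.
Qed.

Lemma slot_visited k q i : q \in entry t T (bk k) ->
  (forall j, rk (k + j)%N (orbit t T b k q j) = i) -> forall r,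
  visited_inf t T b k q r <-> (i, Some r) \in visited_io branch_colors.
Proof.
move=> qk qi r.
have colE j : ((i, Some r) \in branch_colors (k + j)) =
    (r \in visited (mv (bk (k + j))) (orbit t T b k q j)).
  by apply: branch_colors_inl (qi j) r; exact: (orbit_entry lc nll legT).
rewrite visited_ioP; split=> io N.
  by have [j Nj rj] := io N; exists (k + j)%N; rewrite ?colE// (leq_trans Nj)// leq_addl.
have [j Nj] := io (k + N)%N; have kj := leq_trans (leq_addr _ _) Nj.
by rewrite -(subnKC kj) colE => rj; exists (j - k)%N => //; rewrite leq_subRL.
Qed.

Lemma orbit_slot k q : q \in entry t T (bk k) -> exists j i,
  (forall j', rk (k + j + j')%N (orbit t T b (k + j) (orbit t T b k q j) j') = i) /\
  (i, None) \notin visited_io branch_colors.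
Proof.
move=> qk; pose f j := nat_of_ord (rk (k + j)%N (orbit t T b k q j)).
have ej j : orbit t T b k q j \in entry t T (bk (k + j)).
  exact: (orbit_entry lc nll legT).
have [//|j0 _ fE] := @nonincreasing_stable f 0%N.
  move=> j _; rewrite /f addnS; apply: (step_rank (branch_step (k + j))).
  by rewrite run_entry.
exists j0, (rk (k + j0)%N (orbit t T b k q j0)); split.
  move=> j'; rewrite -orbit_add -addnA; apply: val_inj.
  by apply: (fE (j0 + j')%N); exact: leq_addr.
apply/negP => /visited_ioP/(_ (k + j0)%N) [j j0j].
have kj := leq_trans (leq_addr _ _) j0j.
rewrite -(subnKC kj) inE /= => /existsPn/(_ (orbit t T b k q (j - k))).
have jk : (j0 <= j - k)%N by rewrite leq_subRL.
rewrite ej /= -val_eqE /= -/(f _) fE// -val_eqE /= -/(f j0).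
have := fE (j - k).+1 (leqW jk); rewrite {1}/f /= addnS => ->.
by rewrite !eqxx.
Qed.

(** At each late step some token keeps slot [i]; as ranks are injective, it is the descendant of the
    previous one. *)
Lemma slot_orbit i : (i, None) \notin visited_io branch_colors ->
  exists k q, q \in entry t T (bk k) /\
    forall j, rk (k + j)%N (orbit t T b k q j) = i.
Proof.
move=> iN; have [k kP] : exists k, forall j, (k <= j)%N -> (i, None) \notin branch_colors j.
  have [N NP] := not_visited_io branch_colors.
  by exists N => j Nj; apply: contra iN; exact: NP.
have kept j : (k <= j)%N -> exists q, [/\ q \in entry t T (bk j), rk j q = i &
    rk j.+1 (descend (mv (bk j)) (b j) q) = i].
  by move/kP; rewrite inE /= negbK => /existsP[q /and3P[? /eqP ? /eqP ?]]; exists q.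
have [q [qk qi _]] := kept k (leqnn k); exists k, q; split=> // j.
elim: j => [|j IH]; first by rewrite addn0.
have [q' [q'k q'i q'S]] := kept (k + j)%N (leq_addr _ _).
have e : orbit t T b k q j = q' by apply: (@run_rank_inj (bk (k + j))); rewrite IH q'i.
by rewrite addnS /= e.
Qed.

Lemma slots_okP F : slots_ok F (visited_io branch_colors) <->
  forall k q, q \in entry t T (bk k) -> orbit_limsup_in t T F b k q.
Proof.
split=> [ok k q qk|ok].
  have [j0 [i [slot iN]]] := orbit_slot qk.
  apply/(orbit_limsup_in_shift t T F b k q j0).
  have ek := orbit_entry lc nll legT j0 qk.
  have vE := slot_visited ek slot; move: ek vE; set q0 := orbit _ _ _ _ _ _ => ek vE.
  have [r0 r0P] : exists r, visited_inf t T b (k + j0) q0 r.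
    have [N] := @io_pigeonhole Q (fun=> True) (orbit t T b (k + j0) q0)
      (fun N => ex_intro2 _ _ N (leqnn N) I).
    move=> io; exists N => M; have [j [Mj _ <-]] := io M.
    by exists j => //; exact: visited_refl.
  have := @Order.TotalTheory.arg_maxP _ Q _ r0 [pred r | (i, Some r) \in visited_io branch_colors] id.
  case=> [|r rI rmax]; first exact/vE.
  exists r; split; first last.
  - by move=> r' /vE/rmax.
  - exact/vE.
  move: ok => /forallP/(_ i)/forallP/(_ r)/implyP; apply.
  by apply/and3P; split=> //; apply/forallP => r'; apply/implyP => /rmax.
apply/forallP => i; apply/forallP => q; apply/implyP => /and3P[iN qI /forallP mx].
have [k [q0 [q0k slot]]] := slot_orbit iN.
have vE := slot_visited q0k slot.
have [r [rF /vE rI rmax]] := ok _ _ q0k.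
have /rmax qr : visited_inf t T b k q0 q by exact/vE.
have := mx r; rewrite rI /= => rq.
by have -> : q = r by apply/eqP; rewrite eq_le qr rq.
Qed.

End RunBranch.
End Runs.

(** * The automaton *)

Section Automaton.
Context (S : finType) (d : Order.disp_t) (Q : finOrderType d) (A : nzaut S Q).
(* The automaton is described over any ordered type of states encoding pairs of
   a priority and a memory state ([None] is a rejecting sink). *)
Context (d' : Order.disp_t) (Q' : finOrderType d').
Context (dec : Q' -> 'I_#|color Q|.+2 * option (bstate Q)).
Context (enc : 'I_#|color Q|.+2 * option (bstate Q) -> Q').
Hypothesis encK : cancel enc dec.
Hypothesis key_mono : forall z z', (z <= z')%O -> ((dec z).1 <= (dec z').1)%N.

Local Notation zkey z := (nat_of_ord (dec z).1).
Local Notation zst z := ((dec z).2).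

Definition sink : Q' := enc (ord0, None).

Definition bstate0 : bstate Q :=
  ([set init A]%SET, [ffun q => enum_rank q], None, finset.set0, finset.set0,
   finset.set0, finset.set0).

(** The letter [a] of [t] and the directions of the owed tokens are guessed. The last clause is what
    the standing assumption on split transitions from [Fpos] demands. *)
Definition good_split (x : bstate Q) (l : strat_alphabet A) (z : bool -> Q') : Prop :=
  exists (a : S) (dir : Q -> bool),
  [/\ legal_letter a l,
      forall q, q \in b_owe x -> b_track x <> Some q ->
        descend (letter_move a l) (dir q) q \in Fpos A,
      forall c, exists2 y, zst (z c) = Some y & run_step a dir l x c (zkey (z c)) y &
      b_track x <> None -> exists c y, zst (z c) = Some y /\ b_track y <> None].

(** Falling into the sink is always allowed, which makes the transition relation total. *)
Definition b_trans : {set Q' * strat_alphabet A * move Q'} :=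
  [set w | `[< exists z : bool -> Q', w.2 = inr (z false, z true) /\
     ((forall c, z c = sink) \/
      exists2 x, zst w.1.1 = Some x & good_split x w.1.2 z) >]]%SET.

Definition b_final (F : {set Q}) : {set Q'} := [set z | (0 < zkey z)%N &&
  (if zst z is Some x then slots_ok F (b_hit x) else true)]%SET.

(** The sink belongs here so that falling into it respects the standing assumption on [Fpos]; its
    priority 0 makes it rejecting all the same. *)
Definition b_pos : {set Q'} :=
  [set z | if zst z is Some x then b_track x != None else true]%SET.

Lemma sink_trans z l : (z, l, inr (sink, sink)) \in b_trans.
Proof. by rewrite inE; apply/asboolP; exists (fun=> sink); split=> //; left. Qed.

Lemma b_transP z l m : (z, l, m) \in b_trans <->
  exists z' : bool -> Q', m = inr (z' false, z' true) /\
    ((forall c, z' c = sink) \/ exists2 x, zst z = Some x & good_split x l z').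
Proof. by rewrite inE; split => /asboolP. Qed.

Lemma slots_ok_sub (F F' : {set Q}) I : F \subset F' ->
  slots_ok F I -> slots_ok F' I.
Proof.
move=> /fintype.subsetP FF' /forallP ok; apply/forallP => i; apply/forallP => q.
by apply/implyP => /(implyP (forallP (ok i) q))/FF'.
Qed.

Lemma sink_pos : sink \in b_pos.
Proof. by rewrite inE /sink encK. Qed.

Definition strategy_aut : nzaut (strat_alphabet A) Q'.
Proof.
refine (@NzAut _ _ Q' (enc (ord0, Some bstate0)) finset.setT b_trans
  (b_final (Fall A)) (b_final (Fone A)) b_pos _ _ _ _).
- by move=> z l; exists (inr (sink, sink)); exact: sink_trans.
- move=> z l z0 z1 zF /b_transP[z' [[-> ->] [zs|[x zx]]]]; first by rewrite zs sink_pos.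
  case=> a [dir [_ _ _ pos]]; move: zF; rewrite inE zx => /eqP/pos[c [y [zy /eqP yN]]].
  by case: c zy => zy; apply/orP; [right|left]; rewrite inE zy.
- by move=> z l r _ /b_transP[z' []].
- apply/fintype.subsetP => z; rewrite !inE => /andP[-> /=]; case: (dec z).2 => // x.
  exact: slots_ok_sub (Fone_sub_Fall A).
Defined.

Lemma strategy_aut_nondeterministic : nondeterministic strategy_aut.
Proof.
split; first by rewrite /adam finset.setCT.
by move=> z l m /b_transP[z' [-> _]]; exists (z' false), (z' true).
Qed.

(** With [Fall A] full, [slots_ok] holds of every set of colours, and what remains is a nonzero
    priority, which larger states inherit. *)
Lemma strategy_aut_buchi : Fall A = [set: Q]%SET -> buchi (Fall strategy_aut).
Proof.
move=> FT z z'; rewrite !inE => /andP[zk _] /key_mono zz'.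
rewrite (leq_trans zk zz') /=; case: (dec z').2 => // x.
by apply/forallP => i; apply/forallP => q; rewrite FT finset.in_setT implybT.
Qed.

(** * Limsup of a run in terms of the tokens *)

Section RunLimsup.
Hypothesis (lc : limited_choice A) (nll : NLL A).
Context (t : tree S) (T : tree (strat_alphabet A)) (dir : node -> Q -> bool).
Hypothesis (legT : forall n, legal_letter (t n) (T n)).
Context (key : node -> nat) (st : node -> bstate Q).
Hypothesis st0 : st [::] = bstate0.
Hypothesis stS : forall n c,
  run_step (t n) (dir n) (T n) (st n) c (key (rcons n c)) (st (rcons n c)).

(** The three facts on the initial state are what the analysis of runs along a branch starts
    from. *)
Lemma bstate0_entry : b_entry (st [::]) = [set init A]%SET.
Proof. by rewrite st0. Qed.

Lemma bstate0_rank : injective (b_rank (st [::])).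
Proof. by rewrite st0 => q q'; rewrite !ffunE => /enum_rank_inj. Qed.

Lemma bstate0_acc : b_acc (st [::]) = finset.set0.
Proof. by rewrite st0. Qed.

(** Let [J] be the set of recurring colours. Steps of nonzero priority are the breakpoints; if they
    recur, the hits are eventually contained in [J] and infinitely often equal to it, so the largest
    recurring priority is [#|J|.+1]. *)
Lemma run_limsup F b (rho : play strategy_aut) :
  (forall i, zst (rho i).2 = Some (st (mkseq b i)) /\
             zkey (rho i).2 = key (mkseq b i)) ->
  limsup_in (b_final F) rho <->
  (forall N, exists2 k, (N <= k)%N & (0 < key (mkseq b k))%N) /\
  (forall k q, q \in entry t T (mkseq b k) -> orbit_limsup_in t T F b k q).
Proof.
move=> rhoE.
have stb k := branch_step stS b k.
pose J := visited_io (branch_colors t T st b).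
pose V := branch_record t T dir st b.
pose Rb k := b_rec (st (mkseq b k)).
have RS k : Rb k.+1 = record_update (V k) (Rb k) by exact: (step_rec (stb k)).
have hitE k : b_hit (st (mkseq b k.+1)) = record_hit (V k) (Rb k).
  exact: (step_hit (stb k)).
have flag_io : (forall N, exists2 k, (N <= k)%N & (0 < key (mkseq b k))%N) ->
    (forall N, exists2 k, (N <= k)%N & (0 < key (mkseq b k.+1))%N).
  by move=> io N; have [[|k] // Nk kk] := io N.+1; exists k.
have keyE k : (0 < key (mkseq b k.+1))%N ->
    key (mkseq b k.+1) = #|b_hit (st (mkseq b k.+1))|.+1.
  by rewrite (step_key (stb k)); case: ifP.
(* A state of maximal priority among those seen infinitely often has hit set [J]. *)
have hit_max z x : (forall N, exists2 k, (N <= k)%N & (0 < key (mkseq b k))%N) ->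
    inf_often rho z -> zst z = Some x ->
    (forall z', inf_often rho z' -> (z' <= z)%O) -> (0 < zkey z)%N /\ b_hit x = J.
  move=> /flag_io fio zio zx zmax.
  have JE : visited_io V = J.
    apply: (branch_record_io bstate0_entry bstate0_acc stS) => N.
    by have [k Nk kk] := fio N; exists k => //; rewrite (flag_key stS).
  have [N hN] := record_hit_sub RS; rewrite JE in hN.
  have xJ : b_hit x \subset J.
    have [[|k] // Nk kz] := zio N.+1.
    have := (rhoE k.+1).1; rewrite kz zx => -[->]; rewrite hitE; exact: hN.
  have [z' [z'io z'k z'J]] : exists z', [/\ inf_often rho z', (0 < zkey z')%N &
      (#|J|.+1 <= zkey z')%N].
    have : forall N, exists2 k, (N <= k)%N &
        (0 < key (mkseq b k.+1))%N /\ J \subset b_hit (st (mkseq b k.+1)).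
      move=> M; have [J0|[u uJ]] := set_0Vmem J.
        by have [k Mk kk] := fio M; exists k => //; rewrite J0 finset.sub0set.
      have uV : u \in visited_io V by rewrite JE.
      have [k Mk] := sub_record_hit RS M uV; rewrite JE -hitE => Jk.
      exists k => //; split=> //; rewrite -(flag_key stS).
      (* Off breakpoints the hit is empty and cannot contain [u]. *)
      apply: contraTT Jk => nf; rewrite hitE /V /branch_record /step_record (negbTE nf).
      rewrite record_hit0; apply/negP => /fintype.subsetP/(_ u uJ).
      by rewrite finset.in_set0.
    move/(@io_pigeonhole _ _ (fun k => (rho k.+1).2)) => [z' z'P]; exists z'.
    have [k [_ [kk Jk] kz']] := z'P 0%N.
    have kE : zkey z' = key (mkseq b k.+1) by rewrite -kz' (rhoE k.+1).2.
    split; rewrite ?kE//; last by rewrite keyE// ltnS fintype.subset_leq_card.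
    by move=> M; have [j [Mj _ jz']] := z'P M; exists j.+1 => //; exact: leqW.
  have z'z := leq_trans z'J (key_mono (zmax z' z'io)).
  have kz : (0 < zkey z)%N by exact: leq_trans z'z.
  split=> //; apply/eqP; rewrite eqEcard xJ /=.
  have [[|k] // _ kzE] := zio 1%N.
  have kE : zkey z = key (mkseq b k.+1) by rewrite -kzE (rhoE k.+1).2.
  have := (rhoE k.+1).1; rewrite kzE zx => -[->].
  by rewrite -ltnS -keyE -kE.
have okP := slots_okP lc nll legT bstate0_entry bstate0_rank stS b.
split.
  case=> z [zF zio zmax].
  have [k0 _ k0z] := zio 0%N.
  have [zx kz] := rhoE k0; rewrite k0z in zx kz.
  move: zF; rewrite inE zx => /andP[zk ok].
  have fio : forall N, exists2 k, (N <= k)%N & (0 < key (mkseq b k))%N.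
    move=> N; have [k Nk kzE] := zio N; exists k => //.
    by rewrite -(rhoE k).2 kzE.
  have [_ hz] := hit_max _ _ fio zio zx zmax.
by split=> //; apply/okP; rewrite -/J -hz.
case=> fio /okP ok.
have [z0 z0io] : exists z, inf_often rho z.
  have [z zP] := @io_pigeonhole Q' (fun=> True) (fun k => (rho k).2)
    (fun N => ex_intro2 _ _ N (leqnn N) I).
  by exists z => N; have [k [Nk _ kz]] := zP N; exists k.
have := @Order.TotalTheory.arg_maxP _ Q' _ z0 [pred z | `[< inf_often rho z >]] id.
case=> [|z /asboolP zio zmax]; first exact/asboolP.
have {}zmax z' : inf_often rho z' -> (z' <= z)%O by move=> ?; apply: zmax; exact/asboolP.
have [k0 _ k0z] := zio 0%N.
have [zx _] := rhoE k0; rewrite k0z in zx.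
have [zk hz] := hit_max _ _ fio zio zx zmax.
by exists z; split=> //; rewrite inE zk zx hz.
Qed.

End RunLimsup.
End Automaton.

(** * Soundness *)

Section GuidedBranch.
Context (S : finType) (d : Order.disp_t) (Q : finOrderType d) (A : nzaut S Q).
Context (t : tree S) (T : tree (strat_alphabet A)) (D : node -> Q -> bool).

(** Each bit depends on the state of the token, which depends on the earlier bits; nodes and states
    are therefore built together. *)
Lemma guided_branch n q : exists b, cone n b /\ forall j,
  b (size n + j)%N = D (mkseq b (size n + j)) (orbit t T b (size n) q j).
Proof.
pose N j := iter j (fun v : node * Q =>
  (rcons v.1 (D v.1 v.2), descend (move_at t T v.1) (D v.1 v.2) v.2)) (n, q).
have NS j : N j.+1 = (rcons (N j).1 (D (N j).1 (N j).2),
    descend (move_at t T (N j).1) (D (N j).1 (N j).2) (N j).2) by [].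
have szN j : size (N j).1 = (size n + j)%N.
  by elim: j => [|j IH]; rewrite ?addn0// NS size_rcons IH addnS.
have preN j i : prefix (N j).1 (N (j + i)%N).1.
  elim: i => [|i IH]; first by rewrite addn0 prefix_refl.
  by rewrite addnS NS; apply: prefix_trans IH _; exact: prefix_rcons.
pose b k := nth false (N k.+1).1 k.
have bN j : mkseq b (size n + j) = (N j).1.
  apply: (@eq_from_nth _ false); rewrite size_mkseq ?szN// => i ij.
  rewrite nth_mkseq// /b.
  have nthp n1 n2 : prefix n1 n2 -> (i < size n1)%N -> nth false n1 i = nth false n2 i.
    by move=> /prefixP[n3 ->] kn; rewrite nth_cat kn.
  case/orP: (leq_total i.+1 j) => le.
    have := preN i.+1 (j - i.+1)%N; rewrite subnKC// => /nthp; apply.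
    by rewrite szN addnS ltnS leq_addl.
  have := preN j (i.+1 - j)%N; rewrite subnKC// => /nthp e; apply/esym/e.
  by rewrite szN.
have bj j : b (size n + j)%N = D (N j).1 (N j).2.
  by have := bN j.+1; rewrite addnS mkseqS NS => /rcons_inj[_ ->].
exists b; split; first by have := bN 0%N; rewrite addn0.
move=> j; rewrite bj bN; suff -> : orbit t T b (size n) q j = (N j).2 by [].
by elim: j => // j IH; rewrite NS /= IH bN bj.
Qed.

End GuidedBranch.

Section Soundness.
Context (S : finType) (d : Order.disp_t) (Q : finOrderType d) (A : nzaut S Q).
Context (d' : Order.disp_t) (Q' : finOrderType d').
Context (dec : Q' -> 'I_#|color Q|.+2 * option (bstate Q)).
Context (enc : 'I_#|color Q|.+2 * option (bstate Q) -> Q').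
Hypothesis encK : cancel enc dec.
Hypothesis key_mono : forall z z', (z <= z')%O -> ((dec z).1 <= (dec z').1)%N.
Hypothesis (lc : limited_choice A) (nll : NLL A).
Context (R : realType).

Local Notation B := (strategy_aut A encK).
Local Notation zkey z := (nat_of_ord (dec z).1).
Local Notation zst z := ((dec z).2).

Context (T : tree (strat_alphabet A)) (sigma' : strategy Q').
Hypothesis win : winning B R T sigma'.

(** The strategy of Eve may depend on the history, so the unique history leading to each node is
    kept. *)
Definition run : node -> seq (vertex Q') * Q' :=
  node_rec ([::], init B) (fun n hz c =>
    (rcons hz.1 (n, hz.2), (next (sigma' hz.1 (n, hz.2)) (n, hz.2) c).2)).

Local Notation zr n := (run n).2.

Lemma run_rcons n c : run (rcons n c) = (rcons (run n).1 (n, zr n),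
  (next (sigma' (run n).1 (n, zr n)) (n, zr n) c).2).
Proof. exact: node_rec_rcons. Qed.

Lemma run_legal n : exists z' : bool -> Q', [/\ forall c, z' c = zr (rcons n c),
  sigma' (run n).1 (n, zr n) = inr (z' false, z' true) &
  (forall c, z' c = sink enc) \/
    exists2 x, zst (zr n) = Some x & good_split dec x (T n) z'].
Proof.
have [leg _] := win; have := leg (run n).1 (n, zr n).
rewrite /= finset.in_setT => /(_ isT)/b_transP[z' [sE zz']].
exists z'; split=> // c.
by rewrite run_rcons sE; case: c.
Qed.

Lemma play_of_run tau b i : play_of B sigma' tau b i = (mkseq b i, zr (mkseq b i)).
Proof.
suff : iter i (game_step B sigma' tau b) ([::], start B) =
    ((run (mkseq b i)).1, (mkseq b i, zr (mkseq b i))) by rewrite /play_of => ->.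
elim: i => // i IH; rewrite iterS IH mkseqS run_rcons /game_step.
have [z' [_ sE _]] := run_legal (mkseq b i).
have -> h v : chosen B sigma' tau h v = sigma' h v by rewrite /chosen finset.in_setT.
by rewrite sE /= size_mkseq.
Qed.

Lemma legal_no_adam tau : legal B T (adam B) tau.
Proof. by move=> h v; rewrite /adam finset.setCT finset.in_set0. Qed.

(** A dead state only leads to the sink, whose priority 0 contradicts the sure condition. *)
Lemma run_alive n : zst (zr n) <> None.
Proof.
move=> dead; pose b := nth false n.
have dead' k : zst (zr (mkseq b (size n + k))) = None.
  elim: k => [|k IH]; first by rewrite addn0 mkseq_nth.
  rewrite addnS mkseqS; have [z' [<- _ []]] := run_legal (mkseq b (size n + k)).
    by move=> ->; rewrite /sink encK.
  by rewrite IH => -[].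
have [_ W] := win; have [sure _ _] := W sigma' (legal_no_adam _).
have [q [qF qio _]] := sure _ (@consistent_play_of _ _ _ B sigma' sigma' b).
have [i ni] := qio (size n).+1; rewrite play_of_run /= => iE.
move: ni iE; case: i => // i; rewrite ltnS => ni; rewrite mkseqS.
have [z' [<- _ []]] := run_legal (mkseq b i).
  by move=> -> iE; move: qF; rewrite -iE inE /sink encK.
by have := dead' (i - size n)%N; rewrite subnKC// => -> [].
Qed.

Lemma winning_run : exists (t : tree S) (dir : node -> Q -> bool) (st : node -> bstate Q),
  [/\ forall n, zst (zr n) = Some (st n), forall n, legal_letter (t n) (T n),
      forall n q, q \in b_owe (st n) -> b_track (st n) <> Some q ->
        descend (move_at t T n) (dir n q) q \in Fpos A &
      forall n c, run_step (t n) (dir n) (T n) (st n) c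
        (zkey (zr (rcons n c))) (st (rcons n c))].
Proof.
have ex n : exists w : bstate Q * (S * (Q -> bool)),
    [/\ zst (zr n) = Some w.1, legal_letter w.2.1 (T n),
      forall q, q \in b_owe w.1 -> b_track w.1 <> Some q ->
        descend (letter_move w.2.1 (T n)) (w.2.2 q) q \in Fpos A &
      forall c, exists2 y, zst (zr (rcons n c)) = Some y &
        run_step w.2.1 w.2.2 (T n) w.1 c (zkey (zr (rcons n c))) y].
  have [z' [z'E _ [zs|]]] := run_legal n.
    by case: (@run_alive (rcons n true)); rewrite -z'E zs /sink encK.
  case=> x zx [a [dir [la own st _]]]; exists (x, (a, dir)); split=> // c.
  by have [y yE yS] := st c; exists y; rewrite -z'E.
have [w wP] := choice ex.
exists (fun n => (w n).2.1), (fun n => (w n).2.2), (fun n => (w n).1).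
split=> [n|n|n|n c]; try by case: (wP n).
have [_ _ _ /(_ c)[y yE yS]] := wP n.
by have [wE _ _ _] := wP (rcons n c); move: wE; rewrite yE => -[<-].
Qed.

Lemma winning_strategic : exists (t : tree S) (sigma : strategy Q),
  [/\ positional A sigma, winning A R t sigma & T = strategic_tree A sigma].
Proof.
have [t [dir [st [stE legT own stS]]]] := winning_run.
have st0 : st [::] = bstate0 A.
  by have := stE [::]; rewrite /run /node_rec /= encK => -[].
pose sigma : strategy Q := fun h v => if insub v.2 is Some u then T v.1 u else inl v.2.
have sigmaE h n (u : {q | q \in eve A}) : sigma h (n, val u) = T n u.
  by rewrite /sigma /= valK.
exists t, sigma; split; first by [].
- apply: (tokens_winning lc nll legT sigmaE).
  have lim tau b F : limsup_in (b_final dec F) (play_of B sigma' tau b) <->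
      (forall N, exists2 k, (N <= k)%N & (0 < zkey (zr (mkseq b k)))%N) /\
      (forall k q, q \in entry t T (mkseq b k) -> orbit_limsup_in t T F b k q).
    apply: (run_limsup key_mono lc nll legT st0 stS (key := fun n => zkey (zr n))) => i.
    by rewrite play_of_run stE.
  have [_ W] := win; have [sure as_ pos] := W sigma' (legal_no_adam _).
  have {}sure b := sure _ (@consistent_play_of _ _ _ B sigma' sigma' b).
  split.
  + by move=> b k q; have /lim[_] := sure b; exact.
  + move/ae_limsup_coin: as_; apply: ae_coin_imply => b /lim[_ ok] k q.
    exact: ok.
  (* If staying in [Fpos A] has probability zero, the same holds for the descendants of the token
     reached inside [Fpos A] ([lift]), and none of them is ever tracked ([served]): tracking lasts
     forever with positive probability. *)
  move=> n q qn qF; rewrite lt0e measure_ge0 andbT; apply/negP => /eqP null.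
  have lift n1 q1 c : q1 \in Fpos A -> coin R (stay t T n1 q1) = 0%E ->
      coin R (stay t T (rcons n1 c) (descend (move_at t T n1) c q1)) = 0%E.
    move=> q1F n10; apply/eqP; rewrite -measure_le0 -n10.
    apply: le_measure; rewrite ?inE; try exact: measurable_stay.
    by move=> b sb; apply: (stay_rcons (proj1 sb)).
  have served n1 q1 : b_track (st n1) = Some q1 -> q1 \in Fpos A ->
      coin R (stay t T n1 q1) = 0%E -> False.
    move=> tr q1F n10; pose b := nth false n1.
    have bn1 : mkseq b (size n1) = n1 by rewrite mkseq_nth.
    have cs := @fin_consistent_play_of _ _ _ B sigma' sigma' b (size n1).+1.
    rewrite mkseqS play_of_run bn1 in cs.
    have := pos _ _ cs; rewrite play_measure_stays//=.
    rewrite inE stE tr => /(_ isT); apply/negP; rewrite -leNgt -n10.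
    apply: le_measure; rewrite ?inE; last 1 first.
    - move=> b' [/= nb' stb]; rewrite size_mkseq in stb; split=> //.
      have trj j : b_track (st (mkseq b' (size n1 + j))) =
          Some (orbit t T b' (size n1) q1 j).
        elim: j => [|j IH]; first by rewrite addn0 nb'.
        have := stb (size n1 + j.+1)%N (leq_addr _ _).
        rewrite play_of_run /= inE stE addnS mkseqS.
        case E : (b_track _) => [q'|//] _.
        have [_ _ /(_ _ IH) ->] := step_track (stS _ _) E.
        by [].
      move=> [|j] //; have := trj j.+1; rewrite addnS mkseqS => /(step_track (stS _ _)).
      by case.
    - exact: measurable_play_stays.
    - exact: measurable_stay.
  have run_ent m : b_entry (st m) = entry t T m.
    exact: (run_entry (key := fun n => zkey (zr n)) (bstate0_entry st0) stS).
  have flags b := (lim sigma' b (Fall A)).1 (sure b).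
  (* First reach a breakpoint inside [Fpos], so that the token becomes owed. *)
  have [n1 [q1 [q1o q1F n10]]] : exists n1 q1,
      [/\ q1 \in b_owe (st n1), q1 \in Fpos A & coin R (stay t T n1 q1) = 0%E].
    have [D DP] : exists D : node -> Q -> bool, forall m p, p \in Fpos A ->
        descend (move_at t T m) (D m p) p \in Fpos A.
      have ex (mp : node * Q) : exists c, mp.2 \in Fpos A ->
          descend (move_at t T mp.1) c mp.2 \in Fpos A.
        have [pF|] := boolP (mp.2 \in Fpos A); last by exists true.
        by have [c cF] := descend_Fpos lc nll legT mp.1 pF; exists c.
      by have [f fP] := choice ex; exists (fun m p => f (m, p)) => m p; exact: (fP (m, p)).
    have [b [nb bD]] := guided_branch t T D n q.
    have inv j : orbit t T b (size n) q j \in Fpos A /\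
        coin R (stay t T (mkseq b (size n + j)) (orbit t T b (size n) q j)) = 0%E.
      elim: j => [|j [oF o0]]; first by rewrite addn0 nb.
      rewrite addnS mkseqS /=; split; last exact: lift.
      by rewrite bD; exact: DP.
    have [flio _] := flags b.
    have [[|k] // nk kk] := flio (size n).+1; rewrite ltnS in nk.
    have kE : (size n + (k - size n))%N = k by rewrite subnKC.
    have [oF o0] := inv (k - size n).+1; rewrite addnS kE in o0.
    exists (mkseq b k.+1), (orbit t T b (size n) q (k - size n).+1); split=> //.
    have stk := branch_step (key := fun n => zkey (zr n)) stS b k.
    rewrite (step_owe stk); move: kk; rewrite (step_key stk).
    case: ifP => // _ _; rewrite inE oF andbT run_ent.
    have := @orbit_entry _ _ _ _ _ _ lc nll legT b (size n) q (k - size n).+1.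
    by rewrite addnS kE; apply; rewrite nb.
  (* An owed token that is never served prevents any further breakpoint. *)
  have [b [nb bD]] := guided_branch t T dir n1 q1.
  have inv j : [/\ orbit t T b (size n1) q1 j \in b_owe (st (mkseq b (size n1 + j))),
      orbit t T b (size n1) q1 j \in Fpos A,
      coin R (stay t T (mkseq b (size n1 + j)) (orbit t T b (size n1) q1 j)) = 0%E &
      (0 < j)%N -> zkey (zr (mkseq b (size n1 + j))) = 0%N].
    elim: j => [|j [oO oF o0 _]]; first by rewrite addn0 nb.
    set m := mkseq b (size n1 + j) in oO o0 *; set p := orbit _ _ _ _ _ _ in oO oF o0 *.
    have trN : b_track (st m) <> Some p by move=> tr; exact: served tr oF o0.
    have sm := stS m (b (size n1 + j)%N).
    have pn : descend (move_at t T m) (b (size n1 + j)%N) p \in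
        next_owed (t m) (dir m) (T m) (st m) (b (size n1 + j)%N).
      apply: imset_f; rewrite inE oO /= bD eqxx andbT; exact/eqP.
    have no0 : next_owed (t m) (dir m) (T m) (st m) (b (size n1 + j)%N) != finset.set0.
      by apply/set0Pn; exists (descend (move_at t T m) (b (size n1 + j)%N) p).
    rewrite addnS mkseqS -/m /= -/p; split.
    - by rewrite (step_owe sm) ifN.
    - by rewrite bD; exact: own.
    - exact: lift.
    - by rewrite (step_key sm) ifN.
  have [flio _] := flags b.
  have [k nk] := flio (size n1).+1.
  have kE : (size n1 + (k - size n1))%N = k by rewrite subnKC// ltnW.
  have [_ _ _] := inv (k - size n1)%N.
  by rewrite kE subn_gt0 => ->.
- apply/funext => n; apply/ffunP => u; rewrite ffunE; exact/esym/sigmaE.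
Qed.

End Soundness.

(** * Sets of branches of positive measure *)

Section CoinLemmas.
Context (R : realType).

Lemma coin_gt0 (X : set branch) : (coin R X != 0)%E = (0 < coin R X)%E.
Proof. by rewrite lt0e measure_ge0 andbT. Qed.

Lemma coin_gt0_nonempty (X : set branch) : (0 < coin R X)%E -> exists b, X b.
Proof.
move=> X0; apply/set0P; apply/negP => /eqP X00.
by move: X0; rewrite X00 measure0 ltxx.
Qed.

Lemma coin_gt0U (X Y Z : set branch) : measurable (X : set branches) ->
  measurable (Y : set branches) -> measurable (Z : set branches) ->
  X `<=` Y `|` Z -> (0 < coin R X)%E -> (0 < coin R Y)%E \/ (0 < coin R Z)%E.
Proof.
move=> mX mY mZ XYZ; rewrite -!coin_gt0 => X0.
apply/orP; rewrite -negb_and; apply: contra X0 => /andP[/eqP Y0 /eqP Z0].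
rewrite -measure_le0 -[leRHS]adde0 -{1}Y0 -Z0.
apply: (@le_trans _ _ (coin R (Y `|` Z))); last exact: measureU2.
by apply: le_measure; rewrite ?inE//; exact: measurableU.
Qed.

(** The cones in which [Y] is null are countably many, so almost every point of [Y] has only cones
    that meet [Y] with positive measure. *)
Lemma coin_support (Y Z : set branch) m : measurable (Y : set branches) ->
  measurable (Z : set branches) -> (0 < coin R (Y `&` cone m))%E ->
  (forall b, Y b -> cone m b ->
    (forall k, 0 < coin R (Y `&` cone (mkseq b k)))%E -> Z b) ->
  (0 < coin R Z)%E.
Proof.
move=> mY mZ Ym YZ.
pose F i : set branch := if @unpickle node i is Some n
  then (if (0 < coin R (Y `&` cone n))%E then set0 else Y `&` cone n) else set0.
have mYc n : measurable (Y `&` cone n : set branches).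
  by apply: measurableI => //; exact: measurable_cone.
have mF i : measurable (F i : set branches).
  by rewrite /F; case: unpickle => // n; case: ifP.
have mU : measurable (\bigcup_i F i : set branches) by exact: bigcupT_measurable.
case: (@coin_gt0U (Y `&` cone m) Z (\bigcup_i F i)) => //.
  move=> b [Yb mb]; have [Zb|nZ] := pselect (Z b); [by left|right].
  apply: contrapT => nF; apply: nZ; apply: YZ => // k; apply: contrapT => /negP nk.
  apply: nF; exists (pickle (mkseq b k)) => //.
  by rewrite /F pickleK (negbTE nk); split=> //; exact: cone_mkseq.
rewrite -coin_gt0 => /eqP; case.
apply/eqP; rewrite -measure_le0.
apply: le_trans (@measure_sigma_subadditive _ _ _ (coin R) _ F mF mU _) _ => //.
rewrite eseries0// => i _ _; rewrite /F; case: unpickle => [n|]; last exact: measure0.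
by rewrite -coin_gt0; case: ifPn => [_|/negPn/eqP]; [exact: measure0|].
Qed.

(** A cone of depth [K + i.+1] around each [e i] is removed. Their total measure is at most
    [2 ^- K], and [K] is chosen to make this smaller than the measure of [X]. *)
Lemma coin_avoid (X : set branch) (e : nat -> branch) :
  measurable (X : set branches) -> (0 < coin R X)%E ->
  exists Y : set branch, [/\ measurable (Y : set branches), Y `<=` X,
    (0 < coin R Y)%E & forall i, exists k, Y `&` cone (mkseq (e i) k) = set0].
Proof.
move=> mX X0.
have Xfin : coin R X \is a fin_num by exact: fin_num_measure.
have x0 : 0 < fine (coin R X) by rewrite -lte_fin fineK.
pose K := Num.bound (fine (coin R X))^-1.
have Kx : 2 ^- K < fine (coin R X).
  rewrite invf_plt ?posrE ?exprn_gt0//; exact: upper_nthrootP.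
pose F i : set branch := cone (mkseq (e i) (K + i.+1)).
have mF i : measurable (F i : set branches) by exact: measurable_cone.
have mU : measurable (\bigcup_i F i : set branches) by exact: bigcupT_measurable.
have U_le : (coin R (\bigcup_i F i) <= (2 ^- K)%:E)%E.
  apply: le_trans (@measure_sigma_subadditive _ _ _ (coin R) _ F mF mU _) _ => //.
  have := @epsilon_trick R (fun=> 0%E) (2 ^- K) xpredT (fun=> lexx _).
  rewrite invr_ge0 exprn_ge0// [X in (_ <= X + _)%E]eseries0// add0e => /(_ isT); apply: le_trans.
  apply: lee_nneseries => [i _ _|i _]; first exact: measure_ge0.
  rewrite /= /F coin_cone size_mkseq.
  by rewrite add0e lee_fin exprD invfM natrX.
have mD : measurable (X `\` \bigcup_i F i : set branches) by exact: measurableD.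
exists (X `\` \bigcup_i F i); split.
- exact: mD.
- by move=> b [].
- case: (@coin_gt0U X (X `\` \bigcup_i F i) (X `&` \bigcup_i F i)) => //.
  + exact: measurableI.
  + by move=> b Xb; have [Ub|nU] := pselect ((\bigcup_i F i) b); [right|left].
  (* the removed cones are too small to cover [X] *)
  move=> _; rewrite -coin_gt0; apply/negP => /eqP D0.
  move: Kx; rewrite -lte_fin fineK// ltNge => /negP; apply.
  apply: le_trans U_le; rewrite -[leRHS]add0e -D0.
  apply: (@le_trans _ _ (coin R ((X `\` \bigcup_i F i) `|` \bigcup_i F i))); last first.
    exact: measureU2.
  apply: le_measure; rewrite ?inE//; first exact: measurableU.
  by move=> b Xb; have [Ub|nU] := pselect ((\bigcup_i F i) b); [right|left].
- move=> i; exists (K + i.+1)%N; apply/seteqP; split => b //= -[[_ nU] cb].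
  by apply: nU; exists i.
Qed.

End CoinLemmas.

(** A state in the image gets the least rank of its preimages in [E]. These ranks are distinct, so
    as many ranks as states remain, and they are matched in order of enumeration. *)
Lemma rank_extension (Q : finType) (E : {set Q}) (f : Q -> Q)
    (r : {ffun Q -> 'I_#|Q|}) : injective r ->
  exists r' : {ffun Q -> 'I_#|Q|}, injective r' /\
    forall q, q \in E -> (r' (f q) <= r q)%N.
Proof.
move=> rI; pose D := [set f q | q in E]%SET.
have gP y : exists x, y \in D -> [/\ x \in E, f x = y &
    forall x', x' \in E -> f x' = y -> (r x <= r x')%N].
  have [/imsetP[x0 x0E ->]|] := boolP (y \in D); last by exists y.
  case: (@arg_minnP _ x0 [pred x | (x \in E) && (f x == f x0)] (fun x => r x)).
    by rewrite /= x0E eqxx.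
  move=> x /andP[xE /eqP fx] mn; exists x => _; split=> // x' x'E fx'.
  by apply: mn; rewrite /= x'E fx' eqxx.
have [g gE] := choice gP.
pose V := [set r (g y) | y in D]%SET.
have gI : {in D &, injective (fun y => r (g y))}.
  move=> y y' yD y'D /rI gg.
  by have [_ <- _] := gE _ yD; have [_ <- _] := gE _ y'D; rewrite gg.
have cardC : #|~: D| = #|~: V|.
  by rewrite [in LHS]cardsCs [in RHS]cardsCs !finset.setCK (card_in_imset gI) card_ord.
pose r' y := if y \in D then r (g y)
  else nth (r y) (enum (~: V)%SET) (index y (enum (~: D)%SET)).
have idx y : y \notin D -> (index y (enum (~: D)%SET) < size (enum (~: V)%SET))%N.
  by move=> yD; rewrite -cardE -cardC cardE index_mem mem_enum inE.
have nV y : y \notin D -> r' y \notin V.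
  move=> yD; rewrite /r' (negbTE yD).
  by have := mem_nth (r y) (idx y yD); rewrite mem_enum inE.
exists (finfun r'); split=> [y y'|q qE]; rewrite !ffunE.
  have [yD|yD] := boolP (y \in D); have [y'D|y'D] := boolP (y' \in D).
  - by rewrite /r' yD y'D; exact: gI.
  - by move=> e; have := nV y' y'D; rewrite -e /r' yD (imset_f (fun y => r (g y)) yD).
  - by move=> e; have := nV y yD; rewrite e /r' y'D (imset_f (fun y => r (g y)) y'D).
  - rewrite /r' (negbTE yD) (negbTE y'D) (set_nth_default (r y) (r y'))//; last exact: idx.
    move/eqP; rewrite nth_uniq ?idx ?enum_uniq// => /eqP e.
    have yin : y \in enum (~: D)%SET by rewrite mem_enum inE.
    have y'in : y' \in enum (~: D)%SET by rewrite mem_enum inE.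
    by rewrite -(nth_index y yin) e nth_index.
have fD : f q \in D by exact: imset_f.
by rewrite /r' fD; have [_ _] := gE _ fD; exact.
Qed.

(** * Completeness *)

Section Completeness.
Context (S : finType) (d : Order.disp_t) (Q : finOrderType d) (A : nzaut S Q).
Hypothesis (lc : limited_choice A) (nll : NLL A).
Context (R : realType).
Context (t : tree S) (T : tree (strat_alphabet A)).
Hypothesis (legT : forall n, legal_letter (t n) (T n)).
Hypothesis win : tokens_win t T R.

Local Notation mv := (move_at t T).
Local Notation stay n q := (stay t T n q).

Lemma stay_split n q b : stay n q b ->
  stay (rcons n (b (size n))) (descend (mv n) (b (size n)) q) b.
Proof.
move=> [nb st]; split; first exact/cone_rcons.
by move=> j; have := st j.+1; rewrite orbitSl nb size_rcons.
Qed.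

Lemma stay_Fpos n q : (0 < coin R (stay n q))%E -> q \in Fpos A.
Proof. by move=> /coin_gt0_nonempty[b [_ /(_ 0%N)]]. Qed.

(* Every owed token walks towards a child from which it stays in [Fpos] with
   positive probability. *)
Definition walk n q : bool :=
  ~~ (0 < coin R (stay (rcons n false) (descend (mv n) false q)))%E.

Lemma stay_walk n q : (0 < coin R (stay n q))%E ->
  (0 < coin R (stay (rcons n (walk n q)) (descend (mv n) (walk n q) q)))%E.
Proof.
move=> pos; case W : (walk n q); last by move/negbFE: W.
move: W; rewrite /walk => n0.
case: (@coin_gt0U R _ (stay (rcons n false) (descend (mv n) false q))
    (stay (rcons n true) (descend (mv n) true q)) _ _ _ _ pos) => //;
  try exact: measurable_stay; last by rewrite (negbTE n0).
by move=> b /stay_split; case: (b _); [right|left].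
Qed.

Lemma walk_branches : exists w : node -> Q -> branch, forall n q,
  cone n (w n q) /\ forall j, w n q (size n + j)%N =
    walk (mkseq (w n q) (size n + j)) (orbit t T (w n q) (size n) q j).
Proof.
have ex (nq : node * Q) := guided_branch t T walk nq.1 nq.2.
have [f fP] := choice ex.
by exists (fun n q => f (n, q)) => n q; exact: (fP (n, q)).
Qed.

Definition walk_branch : node -> Q -> branch := projT1 (cid walk_branches).

(** A walk is determined by its starting token, which leaves only countably many branches to
    avoid. *)
Lemma walk_branchP n q b : cone n b ->
  (forall j, b (size n + j)%N =
     walk (mkseq b (size n + j)) (orbit t T b (size n) q j)) ->
  b = walk_branch n q.
Proof.
move=> nb bw; have [nb' bw'] := projT2 (cid walk_branches) n q.
rewrite -/walk_branch in nb' bw'; set b' := walk_branch n q in nb' bw' *.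
have e j : mkseq b (size n + j) = mkseq b' (size n + j) /\
    orbit t T b (size n) q j = orbit t T b' (size n) q j.
  elim: j => [|j [e1 e2]]; first by rewrite addn0 nb nb'.
  by rewrite addnS !mkseqS /= bw bw' e1 e2.
apply/funext => i; have [e1 _] := e i.+1.
have := congr1 (fun s => nth false s i) e1.
by rewrite !nth_mkseq// addnS ltnS leq_addl.
Qed.

(* While the token [(n, q)] is tracked, the run only follows branches of
   [region n q]; every walking token leaves this set. *)
Lemma regions : exists Y : node -> Q -> set branch, forall n q,
  (0 < coin R (stay n q))%E ->
  [/\ measurable (Y n q : set branches), Y n q `<=` stay n q, (0 < coin R (Y n q))%E &
    forall n' q', exists k, Y n q `&` cone (mkseq (walk_branch n' q') k) = set0].
Proof.
have ex (nq : node * Q) : exists Y : set branch,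
    (0 < coin R (stay nq.1 nq.2))%E ->
    [/\ measurable (Y : set branches), Y `<=` stay nq.1 nq.2, (0 < coin R Y)%E &
    forall n' q', exists k, Y `&` cone (mkseq (walk_branch n' q') k) = set0].
  have [pos|] := boolP (0 < coin R (stay nq.1 nq.2))%E; last by exists set0.
  pose e i := if @unpickle (node * Q)%type i is Some v then walk_branch v.1 v.2
    else fun=> false.
  have [|Y [mY sY posY av]] := @coin_avoid R (stay nq.1 nq.2) e _ pos.
    exact: measurable_stay.
  exists Y => _; split=> // n' q'; have [k kP] := av (pickle (n', q')).
  by exists k; move: kP; rewrite /e pickleK.
have [f fP] := choice ex.
by exists (fun n q => f (n, q)) => n q; exact: (fP (n, q)).
Qed.

Definition region : node -> Q -> set branch := projT1 (cid regions).

Lemma regionP n q : (0 < coin R (stay n q))%E ->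
  [/\ measurable (region n q : set branches), region n q `<=` stay n q,
    (0 < coin R (region n q))%E &
    forall n' q', exists k, region n q `&` cone (mkseq (walk_branch n' q') k) = set0].
Proof. exact: (projT2 (cid regions)). Qed.

Definition in_region (v : node * Q) n : bool :=
  (0 < coin R (region v.1 v.2 `&` cone n))%E.

Definition extend_rank (E : {set Q}) (f : Q -> Q) (r : {ffun Q -> 'I_#|Q|}) :
    {ffun Q -> 'I_#|Q|} :=
  if pselect (injective r) is left rI then projT1 (cid (rank_extension E f rI)) else r.

Lemma extend_rankP E f (r : {ffun Q -> 'I_#|Q|}) : injective r -> injective (extend_rank E f r) /\
  forall q, q \in E -> (extend_rank E f r (f q) <= r q)%N.
Proof.
by move=> rI; rewrite /extend_rank; case: pselect => // rI'; exact: (projT2 (cid (rank_extension E f rI'))).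
Qed.

(* Priority, memory state, and the node and state in which the tracking of the
   current token started. *)
Definition rstate : Type := (nat * bstate Q * (node * Q))%type.

(** When the tracked region is left, tracking pauses for one node; a new token is then picked among
    the owed ones, and its node becomes the new context. *)
Definition rstep (n : node) (z : rstate) (c : bool) : rstate :=
  let x := z.1.2 in let n' := rcons n c in
  let E := next_entry A (t n) (mv n) c (b_entry x) in
  let O1 := next_owed (t n) (walk n) (T n) x c in
  let O := if O1 == finset.set0 then (E :&: Fpos A)%SET else O1 in
  let r := extend_rank (b_entry x) (descend (mv n) c) (b_rank x) in
  let pw := if b_track x is Some q then
              if in_region z.2 n' then (Some (descend (mv n) c q), z.2) else (None, z.2)
            else if [pick q in O] is Some q then (Some q, (n', q)) else (None, z.2) in
  let V := step_record (t n) (walk n) (T n) x c r in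
  let H := record_hit V (b_rec x) in
  (if O1 == finset.set0 then #|H|.+1 else 0%N,
   (E, r, pw.1, O,
    if O1 == finset.set0 then finset.set0 else step_colors (t n) (T n) x c r,
    record_update V (b_rec x), H), pw.2).

Definition rrun : node -> rstate :=
  node_rec (0%N, bstate0 A, ([::], init A)) rstep.

Lemma rrun_rcons n c : rrun (rcons n c) = rstep n (rrun n) c.
Proof. exact: node_rec_rcons. Qed.

Local Notation key n := (rrun n).1.1.
Local Notation st n := (rrun n).1.2.
Local Notation ctx n := (rrun n).2.

Definition tracking n q : Prop :=
  [/\ (0 < coin R (stay (ctx n).1 (ctx n).2))%E, in_region (ctx n) n,
      q \in entry t T n &
      forall b, region (ctx n).1 (ctx n).2 b -> cone n b -> stay n q b].

Lemma tracking_Fpos n q : tracking n q -> q \in Fpos A.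
Proof.
case=> _ /coin_gt0_nonempty[b [Yb nb]] _ /(_ b Yb nb)[_ /(_ 0%N)].
by [].
Qed.

Lemma rstep_owe n c : b_owe (st (rcons n c)) =
  if next_owed (t n) (walk n) (T n) (st n) c == finset.set0
  then (b_entry (st (rcons n c)) :&: Fpos A)%SET
  else next_owed (t n) (walk n) (T n) (st n) c.
Proof. by rewrite rrun_rcons. Qed.

Lemma rstep_track n c : (b_track (st (rcons n c)), ctx (rcons n c)) =
  if b_track (st n) is Some q then
    if in_region (ctx n) (rcons n c) then (Some (descend (mv n) c q), ctx n)
    else (None, ctx n)
  else if [pick q in b_owe (st (rcons n c))] is Some q then (Some q, (rcons n c, q))
  else (None, ctx n).
Proof. by rewrite rstep_owe rrun_rcons; exact/esym/surjective_pairing. Qed.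

Lemma rrun_invariant n : [/\ b_entry (st n) = entry t T n,
  injective (b_rank (st n)), b_owe (st n) \subset (entry t T n :&: Fpos A)%SET &
  forall q, b_track (st n) = Some q -> tracking n q].
Proof.
have [_ _ pos] := win.
elim/last_ind: n => [|n c [entE rI oweE trk]].
  split=> //; last exact: finset.sub0set.
  by move=> q q'; rewrite /= !ffunE => /enum_rank_inj.
have entE' : b_entry (st (rcons n c)) = entry t T (rcons n c).
  by rewrite rrun_rcons /= entry_rcons entE.
have oweE' : b_owe (st (rcons n c)) \subset (entry t T (rcons n c) :&: Fpos A)%SET.
  rewrite rstep_owe entE'; case: ifP => // _; apply/fintype.subsetP => q'.
  case/imsetP => q; rewrite inE => /and3P[qO _ /eqP <-] ->.
  have := fintype.subsetP oweE q qO; rewrite inE => /andP[qn qF].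
  rewrite inE (descend_entry lc nll legT) ?entry_reach//=.
  exact/stay_Fpos/stay_walk/pos.
split=> //; first by rewrite rrun_rcons /=; apply: (extend_rankP _ _ rI).1.
move=> q' tr; have := rstep_track n c; rewrite tr.
case E : (b_track (st n)) => [q|].
  case: ifP => // reg [-> ctxE]; have [p0 _ qn sub] := trk q E.
  rewrite /tracking ctxE reg; split=> //.
    by apply: (descend_entry lc nll legT); exact: entry_reach.
  by move=> b Yb /cone_rcons[nb <-]; apply: stay_split; exact: sub.
case: pickP => // q qO [-> ctxE].
have := fintype.subsetP oweE' q qO; rewrite inE => /andP[qn qF].
have sp := pos _ _ qn qF; have [mY sY posY _] := regionP sp.
rewrite /tracking ctxE; split=> //=; last by move=> b /sY.
rewrite /in_region /= (_ : _ `&` _ = region (rcons n c) q)//.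
by apply/seteqP; split => b; [case|move=> Yb; split=> //; case: (sY b Yb)].
Qed.

Lemma rrun_step n c : run_step (t n) (walk n) (T n) (st n) c
  (key (rcons n c)) (st (rcons n c)).
Proof.
have [_ rI _ _] := rrun_invariant n.
have [entE' rI' _ trk'] := rrun_invariant (rcons n c).
split=> //.
- by move=> q qE; rewrite rrun_rcons /=; apply: (extend_rankP _ _ rI).2.
- by rewrite rrun_rcons.
- move=> q' tr; have trq := trk' _ tr; split.
  + by rewrite entE'; case: trq.
  + exact: tracking_Fpos trq.
  + move=> q E; have := rstep_track n c; rewrite tr E.
    by case: ifP => // _ [].
- exact: rstep_owe.
- by rewrite rrun_rcons.
- by rewrite rrun_rcons.
- by rewrite rrun_rcons.
- by rewrite rrun_rcons.
Qed.

(** Without breakpoints the number of debts never grows. Once it is constant, no owed token is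
    served and all walk along [b], so [b] is a walk; but every region leaves every walk, and the
    token picked next is an owed one. *)
Lemma rrun_flags b N : exists2 k, (N <= k)%N & (0 < key (mkseq b k))%N.
Proof.
apply: contrapT => nex.
have nofl k : (N <= k)%N ->
    next_owed (t (mkseq b k)) (walk (mkseq b k)) (T (mkseq b k)) (st (mkseq b k)) (b k)
      != finset.set0.
  move=> Nk; apply/negP => fl; apply: nex; exists k.+1; first exact: leqW.
  by have := step_key (rrun_step (mkseq b k) (b k)); rewrite fl -mkseqS => ->.
have oweS k : (N <= k)%N -> b_owe (st (mkseq b k.+1)) =
    next_owed (t (mkseq b k)) (walk (mkseq b k)) (T (mkseq b k)) (st (mkseq b k)) (b k).
  by move=> Nk; rewrite mkseqS rstep_owe ifN// nofl.
pose G k := [set q in b_owe (st (mkseq b k)) |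
  (b_track (st (mkseq b k)) != Some q) && (walk (mkseq b k) q == b k)]%SET.
have Gsub k : G k \subset b_owe (st (mkseq b k)).
  by apply/fintype.subsetP => q; rewrite inE => /andP[].
have oweG k : (N <= k)%N -> (#|b_owe (st (mkseq b k.+1))| <= #|G k|)%N.
  by move=> Nk; rewrite oweS//; exact: leq_imset_card.
have [k Nk|N' NN' cE] := @nonincreasing_stable (fun k => #|b_owe (st (mkseq b k))|) N.
  exact: leq_trans (oweG k Nk) (fintype.subset_leq_card (Gsub k)).
(* From [N'] on, no owed token is lost: none is served, and all walk along [b]. *)
have Gall k : (N' <= k)%N -> G k = b_owe (st (mkseq b k)).
  move=> N'k; apply/eqP; rewrite eqEcard Gsub /= (cE k)// -(cE k.+1) ?leqW//.
  by apply: oweG; exact: leq_trans N'k.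
have along k q : (N' <= k)%N -> q \in b_owe (st (mkseq b k)) ->
    [/\ b_track (st (mkseq b k)) <> Some q, walk (mkseq b k) q = b k &
      descend (mv (mkseq b k)) (b k) q \in b_owe (st (mkseq b k.+1))].
  move=> N'k qO; have qG : q \in G k by rewrite Gall.
  move: (qG); rewrite inE => /and3P[_ /eqP tr /eqP wE]; split=> //.
  by rewrite oweS ?(leq_trans NN')//; exact: imset_f.
pose k1 := N'.+1.
have [q1 q1O] : exists q, q \in b_owe (st (mkseq b k1)).
  by apply/set0Pn; rewrite oweS// nofl.
have orbO j : orbit t T b k1 q1 j \in b_owe (st (mkseq b (k1 + j))).
  elim: j => [|j IH]; first by rewrite addn0.
  rewrite addnS /=; have [|//] := along (k1 + j)%N _ _ IH.
  by rewrite /k1 addSn ltnW// ltnS leq_addr.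
have bE : b = walk_branch (mkseq b k1) q1.
  apply: walk_branchP => [|j]; first exact: cone_mkseq.
  rewrite size_mkseq.
  have [|_ <- _] := along (k1 + j)%N _ _ (orbO j); last by [].
  by rewrite /k1 addSn ltnW// ltnS leq_addr.
(* The region currently tracked is left along [b], after which an owed token
   must be served. *)
have [k k1k trN] : exists2 k, (k1 <= k)%N & b_track (st (mkseq b k)) = None.
  apply: contrapT => nN.
  have trS k : (k1 <= k)%N -> exists q, b_track (st (mkseq b k)) = Some q.
    move=> k1k; case E : (b_track (st (mkseq b k))) => [q|]; first by exists q.
    by case: nN; exists k.
  have ctxE j : ctx (mkseq b (k1 + j)) = ctx (mkseq b k1) /\
      in_region (ctx (mkseq b k1)) (mkseq b (k1 + j)).
    elim: j => [|j [IH1 IH2]].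
      rewrite addn0; split=> //; have [q qE] := trS _ (leqnn k1).
      have [_ _ _ /(_ _ qE)] := rrun_invariant (mkseq b k1).
      by case.
    have [q qE] := trS (k1 + j)%N (leq_addr _ _).
    have [q' q'E] := trS (k1 + j.+1)%N (leq_addr _ _).
    move: q'E; rewrite addnS mkseqS => q'E.
    have := rstep_track (mkseq b (k1 + j)) (b (k1 + j)%N).
    by rewrite qE q'E IH1; case: ifP => // reg [_ ->].
  have [q qE] := trS _ (leqnn k1).
  have [_ _ _ /(_ _ qE)[p0 _ _ _]] := rrun_invariant (mkseq b k1).
  have [_ _ _ /(_ (mkseq b k1) q1)[k kP]] := regionP p0.
  rewrite -bE in kP.
  have [_ /coin_gt0_nonempty[b' [Yb' b'k]]] := ctxE k.
  suff : (region (ctx (mkseq b k1)).1 (ctx (mkseq b k1)).2 `&` cone (mkseq b k)) b'.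
    by rewrite kP.
  split=> //; apply: cone_prefix b'k; rewrite prefixE size_mkseq take_mkseq//.
  exact: leq_addl.
have N'k : (N' <= k)%N by exact: ltnW.
have := rstep_track (mkseq b k) (b k); rewrite trN -mkseqS.
case: pickP => [q qO [trq _]|O0].
  by have [] := along k.+1 q (leqW N'k) qO.
have /set0Pn[q qO] : b_owe (st (mkseq b k.+1)) != finset.set0.
  by rewrite oweS ?nofl// (leq_trans NN').
by have := O0 q; rewrite qO.
Qed.

Lemma rrun_track_child n : b_track (st n) <> None ->
  exists c, b_track (st (rcons n c)) <> None.
Proof.
case E : (b_track (st n)) => [q|//] _.
have [_ _ _ /(_ _ E)[p0 reg _ _]] := rrun_invariant n.
have [mY _ _ _] := regionP p0.
have mYc m : measurable (region (ctx n).1 (ctx n).2 `&` cone m : set branches).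
  by apply: measurableI => //; exact: measurable_cone.
have [c regc] : exists c, in_region (ctx n) (rcons n c).
  case: (@coin_gt0U R _ _ _ (mYc n) (mYc (rcons n true)) (mYc (rcons n false)) _ reg).
  - move=> b [Yb nb]; case bn : (b (size n)); [left|right]; split=> //; exact/cone_rcons.
  - by exists true.
  - by exists false.
by exists c; have := rstep_track n c; rewrite E regc => -[->].
Qed.

(** Almost every branch of the region meets it with positive measure in each of its cones, and along
    such a branch tracking never stops. *)
Lemma rrun_track_stays n : b_track (st n) <> None -> forall Z : set branch,
  measurable (Z : set branches) ->
  (forall b, cone n b -> (forall k, (size n <= k)%N -> b_track (st (mkseq b k)) <> None) ->
     Z b) -> (0 < coin R Z)%E.
Proof.
case E : (b_track (st n)) => [q|//] _ Z mZ ZP.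
have [_ _ _ /(_ _ E)[p0 reg _ _]] := rrun_invariant n.
have [mY _ _ _] := regionP p0.
apply: (coin_support mY mZ reg) => b Yb nb inY; apply: ZP => // k nk.
suff : forall j, b_track (st (mkseq b (size n + j))) <> None /\
    ctx (mkseq b (size n + j)) = ctx n by move=> /(_ (k - size n)%N)[]; rewrite subnKC.
elim=> [|j [IH1 IH2]]; first by rewrite addn0 nb E.
rewrite addnS mkseqS; case Ej : (b_track _) IH1 => [p|//] _.
have := rstep_track (mkseq b (size n + j)) (b (size n + j)%N); rewrite Ej IH2.
by rewrite /in_region -mkseqS inY => -[-> ->].
Qed.

(** * The run as a winning strategy for the automaton *)

Section RunStrategy.
Context (d' : Order.disp_t) (Q' : finOrderType d').
Context (dec : Q' -> 'I_#|color Q|.+2 * option (bstate Q)).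
Context (enc : 'I_#|color Q|.+2 * option (bstate Q) -> Q').
Hypothesis encK : cancel enc dec.
Hypothesis key_mono : forall z z', (z <= z')%O -> ((dec z).1 <= (dec z').1)%N.

Local Notation B := (strategy_aut A encK).

Definition run_state n : Q' := enc (inord (key n), Some (st n)).

Lemma run_stateE n : (dec (run_state n)).2 = Some (st n) /\
  nat_of_ord (dec (run_state n)).1 = key n.
Proof.
rewrite /run_state encK; split=> //=; rewrite inordK//.
(* A priority is 0 or one more than the size of a set of colours, hence below [#|color Q|.+2]. *)
elim/last_ind: n => // n c _; rewrite (step_key (rrun_step n c)).
by case: ifP => // _; rewrite !ltnS max_card.
Qed.

Definition run_strategy : strategy Q' := fun _ v =>
  if v.2 == run_state v.1 then inr (run_state (rcons v.1 false), run_state (rcons v.1 true))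
  else inr (sink enc, sink enc).

Lemma run_strategy_legal : legal B T (eve B) run_strategy.
Proof.
move=> h [n z] _; rewrite /run_strategy /=; case: eqP => [->|_]; last exact: sink_trans.
apply/b_transP; exists (fun c => run_state (rcons n c)); split=> //; right.
have [entE _ oweE _] := rrun_invariant n.
exists (st n); first exact: (run_stateE n).1.
exists (t n), (walk n); split.
- exact: legT.
- move=> q qO _; have := fintype.subsetP oweE q qO; rewrite inE => /andP[qn qF].
  by have [_ _ pos] := win; exact/stay_Fpos/stay_walk/pos.
- move=> c; exists (st (rcons n c)); first exact: (run_stateE _).1.
  by rewrite (run_stateE _).2; exact: rrun_step.
- move=> /rrun_track_child[c tr]; exists c, (st (rcons n c)); split=> //.
  exact: (run_stateE _).1.
Qed.

Lemma play_of_run_strategy tau b i :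
  play_of B run_strategy tau b i = (mkseq b i, run_state (mkseq b i)).
Proof.
elim: i => [|i IH].
  rewrite /play_of /= /start /=; congr (_, _); rewrite /run_state; congr (enc (_, _)).
  by apply: val_inj; rewrite /= inordK.
rewrite play_ofS IH /chosen finset.in_setT /run_strategy /= eqxx /= size_mkseq.
by rewrite mkseqS; case: (b i).
Qed.

Lemma run_strategy_winning : winning B R T run_strategy.
Proof.
have [sure as_ _] := win; split; first exact: run_strategy_legal.
move=> tau _.
have lim b F : limsup_in (b_final dec F) (play_of B run_strategy tau b) <->
    (forall k q, q \in entry t T (mkseq b k) -> orbit_limsup_in t T F b k q).
  have E : limsup_in (b_final dec F) (play_of B run_strategy tau b) <->
    (forall N, exists2 k, (N <= k)%N & (0 < key (mkseq b k))%N) /\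
    (forall k q, q \in entry t T (mkseq b k) -> orbit_limsup_in t T F b k q).
    apply: (@run_limsup _ _ _ A _ _ _ _ encK key_mono lc nll t T walk legT
      (fun n => key n) (fun n => st n) (erefl _) rrun_step) => i.
    rewrite play_of_run_strategy; exact: run_stateE.
  by rewrite E; split=> [[]//|ok]; split=> //; exact: rrun_flags.
split.
- by move=> rho /consistent_branch[b ->]; apply/lim => k q; exact: sure.
- by apply/ae_limsup_coin; apply: ae_coin_imply as_ => b ok; apply/lim.
move=> s [m z] cs /= zF; rewrite play_measure_stays//.
have [b mb] : exists b, cone m b by exists (nth false m); rewrite /cone /= mkseq_nth.
have : play_of B run_strategy tau b \in cylinder (A := B) (rcons s (m, z)).
  by rewrite play_of_cylinder cs last_rcons /=; exact/mem_set.
move/set_mem; rewrite /cylinder /mkset size_rcons mkseqS => /rcons_inj[_].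
rewrite play_of_run_strategy => -[mE zE].
have sz : size s = size m by rewrite -mE size_mkseq.
move: zF; rewrite -zE inE (run_stateE _).1 mE => /eqP trm.
apply: (rrun_track_stays trm); first exact: (measurable_play_stays cs).
move=> b' mb' tr; split=> // i; rewrite sz => si.
by rewrite play_of_run_strategy /= inE (run_stateE _).1; apply/eqP; exact: tr.
Qed.

End RunStrategy.

End Completeness.

(** * Size of the automaton *)

Lemma card_set_type (X : finType) : #|{set X}| = (2 ^ #|X|)%N.
Proof.
transitivity #|[set: {set X}]%SET|; first by rewrite cardsT.
by rewrite -finset.powersetT card_powerset cardsT.
Qed.

Lemma leq_exp2 k : (k <= 2 ^ k)%N.
Proof. exact/ltnW/ltn_expl. Qed.

Lemma leq_expr k m n : (m <= n)%N -> (m ^ k <= n ^ k)%N.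
Proof. by case: k => // k mn; rewrite leq_exp2r. Qed.

Lemma card_color (Q : finType) : (0 < #|Q|)%N -> (#|color Q| <= 2 * #|Q| ^ 2)%N.
Proof. by move=> Q0; rewrite card_prod card_option card_ord; nia. Qed.

(** The term [3 * #|Q|] pays for the entry states, the tracked token and the debts, [#|Q| ^ 2] for
    the ranks, [2 * #|color Q|] for the accumulated colours and the hit, and the last square for the
    record. *)
Lemma card_bstate (Q : finType) : (#|bstate Q| <=
  2 ^ (3 * #|Q| + #|Q| ^ 2 + 2 * #|color Q| + #|color Q| ^ 2))%N.
Proof.
rewrite /bstate !(card_prod, card_set_type) !card_option card_ffun !card_ord.
set n := #|Q|; set c := (n * n.+1)%N.
have -> : (3 * n + n ^ 2 + 2 * c + c ^ 2 = n + n * n + n + n + c + c * c + c)%N.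
  by rewrite -!mulnn; lia.
rewrite !expnD; do 4!(apply: leq_mul; last exact: leqnn).
apply: leq_mul; last exact: ltn_expl.
apply: leq_mul; first exact: leqnn.
by rewrite expnM; exact: leq_expr (leq_exp2 n).
Qed.

Lemma card_move (Q : finType) : (#|{: move Q}| <= 2 ^ (2 * #|Q|))%N.
Proof.
rewrite card_sum card_prod mul2n -addnn expnD -{1}[#|Q|]muln1 -mulnDr add1n.
by apply: leq_mul; [exact: leq_exp2|exact: ltn_expl].
Qed.

Lemma card_strat_alphabet (S : finType) d (Q : finOrderType d) (A : nzaut S Q) :
  (#|strat_alphabet A| <= 2 ^ (2 * #|Q| ^ 2))%N.
Proof.
rewrite /strat_alphabet card_ffun -mulnn mulnA expnM.
apply: (@leq_trans ((2 ^ (2 * #|Q|)) ^ #|{: {q : Q | q \in eve A}}|)).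
  exact: leq_expr (card_move Q).
by apply: leq_pexp2l; [rewrite expn_gt0|rewrite card_sig max_card].
Qed.

Section SortedStates.
Context (Q : finType).

(** The lexicographic product puts the priority first, so the order refines it; ties are broken by
    an arbitrary enumeration. *)
Definition lex_state : finOrderType _ :=
  ('I_#|color Q|.+2 *l 'I_#|{: option (bstate Q)}|)%type.

Definition lex_dec (z : lex_state) : 'I_#|color Q|.+2 * option (bstate Q) :=
  (z.1, enum_val z.2).

Definition lex_enc (p : 'I_#|color Q|.+2 * option (bstate Q)) : lex_state :=
  (p.1, enum_rank p.2).

Lemma lex_encK : cancel lex_enc lex_dec.
Proof. by case=> k x; rewrite /lex_dec /= enum_rankK. Qed.

Lemma lex_key_mono (z z' : lex_state) :
  (z <= z')%O -> ((lex_dec z).1 <= (lex_dec z').1)%N.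
Proof. by rewrite leEprodlexi => /andP[]. Qed.

(** With [n] states and [c <= 2 * n ^ 2] colours, the exponent [3 * c + c ^ 2 + 3 * n + n ^ 2 + 2]
    is at most 6 + 4 + 3 + 1 + 2 = 16 times [n ^ 4]. *)
Lemma card_lex_state : (0 < #|Q|)%N -> (#|lex_state| <= 2 ^ (16 * #|Q| ^ 4))%N.
Proof.
move=> Q0; rewrite card_prod !card_ord card_option.
have := card_bstate Q; have := card_color Q0.
set n := #|Q|; set c := #|color Q|; set N := #|bstate Q| => cn Nle.
apply: (@leq_trans (2 ^ c.+1 * 2 ^ (3 * n + n ^ 2 + 2 * c + c ^ 2).+1)).
  apply: leq_mul; first exact: ltn_expl.
  rewrite expnS mul2n -addnn -add1n; apply: leq_add => //.
  by rewrite expn_gt0.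
rewrite -expnD leq_exp2l//.
have c2 : (c ^ 2 <= 4 * n ^ 4)%N by rewrite -!mulnn; nia.
have n1 : (n <= n ^ 4)%N by nia.
have n2 : (n ^ 2 <= n ^ 4)%N by rewrite leq_pexp2l.
lia.
Qed.

End SortedStates.

Lemma card_strategy_aut (S : finType) d (Q : finOrderType d) (A : nzaut S Q) :
  (aut_size (strategy_aut A (@lex_encK Q)) <= 2 ^ (52 * #|Q| ^ 4))%N.
Proof.
have Q0 : (0 < #|Q|)%N by apply/card_gt0P; exists (init A).
have := card_lex_state Q0; have := card_strat_alphabet A.
rewrite /aut_size.
have : (#|trans (strategy_aut A (@lex_encK Q))| <=
  #|lex_state Q| * #|strat_alphabet A| * #|{: move (lex_state Q)}|)%N.
  by rewrite -!card_prod max_card.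
have -> : #|{: move (lex_state Q)}| = (#|lex_state Q| + #|lex_state Q| * #|lex_state Q|)%N.
  by rewrite card_sum; congr (_ + _)%N; exact: card_prod.
set n := #|Q|; set N := #|lex_state Q|; set L := #|strat_alphabet A|.
move=> ML LL NN; have n2 : (n ^ 2 <= n ^ 4)%N by rewrite leq_pexp2l.
have n4 : (0 < n ^ 4)%N by rewrite expn_gt0 Q0.
(* Each of the factors [N] and [N.+1] contributes 16, and the successor one more. *)
have M2 : (N + N * N <= 2 ^ (33 * n ^ 4))%N.
  have -> : (N + N * N = N * N.+1)%N by rewrite mulnS.
  apply: (@leq_trans (2 ^ (16 * n ^ 4) * 2 ^ (16 * n ^ 4).+1)).
    apply: leq_mul => //; rewrite (expnS 2 (16 * n ^ 4)) mul2n -addnn -add1n.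
    by apply: leq_add => //; rewrite expn_gt0.
  by rewrite -expnD leq_exp2l//; lia.
(* The exponent 51 is [16 + 2 + 33], for the source, the letter and the move of a transition; adding
   the states costs one more. *)
apply: (@leq_trans (2 ^ (51 * n ^ 4) + 2 ^ (51 * n ^ 4))).
  apply: leq_add; first by apply: (leq_trans NN); rewrite leq_exp2l//; lia.
  apply: (leq_trans ML).
  apply: (@leq_trans (2 ^ (16 * n ^ 4) * 2 ^ (2 * n ^ 2) * 2 ^ (33 * n ^ 4))).
    by apply: leq_mul => //; exact: leq_mul.
  by rewrite -!expnD leq_exp2l//; lia.
by rewrite addnn -mul2n -(expnS 2) leq_exp2l//; lia.
Qed.

Theorem theorem20 (R : realType) :
  exists c e : nat,
  forall (S : finType) (d : Order.disp_t) (Q : finOrderType d) (A : nzaut S Q),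
  limited_choice A -> NLL A ->
  exists (d' : Order.disp_t) (Q' : finOrderType d')
         (B : nzaut (strat_alphabet A) Q'),
  [/\ nondeterministic B,
      forall T : tree (strat_alphabet A),
        accepts B R T <->
        exists (t : tree S) (sigma : strategy Q),
          [/\ positional A sigma, winning A R t sigma & T = strategic_tree A sigma],
      (aut_size B <= 2 ^ (c * #|Q| ^ e))%N &
      Fall A = [set: Q]%SET -> buchi (Fall B)].
Proof.
exists 52%N, 4%N => S d Q A lc nll.
have mono := @lex_key_mono Q.
exists _, (lex_state Q), (strategy_aut A (@lex_encK Q)); split.
- exact: strategy_aut_nondeterministic.
- move=> T; split=> [[sigma' win]|[t [sigma [pos win TE]]]].
    exact: (winning_strategic mono lc nll win).
  have sigmaE h n (u : {q | q \in eve A}) : sigma h (n, val u) = T n u.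
    by rewrite TE ffunE; apply: pos; exact: valP.
  have legT n : legal_letter (t n) (T n).
    apply/forallP => u; rewrite -(sigmaE [::]).
    by have [leg _] := win; apply: (leg [::] (n, val u)); exact: valP.
  have tw := winning_tokens lc nll legT sigmaE win.
  exists (run_strategy R t T (@lex_enc Q)).
  exact: run_strategy_winning.
- exact: card_strategy_aut.
- exact: (strategy_aut_buchi mono).
Qed.
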